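(* Let $W$ be a flagfold in an open set $\Omega\subset\mathbb{R}^n$ with locally bounded first variation; identify $\delta W$ with a vector Radon measure in $\Omega$ and let $|\delta W|$ be its total variation. Let $x\in\Omega$ and assume that $\Lambda\ge0$, $0<d^\ast\le n$ and $0<\rho^\ast<\mathrm{dist}(x,\mathbb{R}^n\setminus\Omega)$ satisfy, for all $0<\rho\le\rho^\ast$, $$\int_{B_\rho(x)}(\overline d(y)-d^\ast)\,d\|W\|(y)\ge0\quad\text{and}\quad|\delta W|(B_\rho(x))\le\Lambda\,\|W\|(B_\rho(x)).$$ Then $\rho\mapsto e^{\Lambda\rho}\rho^{-d^\ast}\|W\|(B_\rho(x))$ is non-decreasing (on $]0,\rho^\ast]$). Moreover, in the particular case where $\delta W=0$, for all $0<\sigma<\xi<\mathrm{dist}(x,\mathbb{R}^n\setminus\Omega)$, $$\frac{\|W\|(B_\xi(x))}{\xi^{d^\ast}}-\frac{\|W\|(B_\sigma(x))}{\sigma^{d^\ast}}=\int_{(B_\xi(x)\setminus B_\sigma(x))\times\mathcal{W}\mathcal{F}(n)}\frac{\overline S^\perp(y-x)\cdot(y-x)}{|y-x|^{d^\ast+2}}\,dW(y,S)+\int_\sigma^\xi\rho^{-d^\ast-1}\int_{B_\rho(x)}(\overline d(y)-d^\ast)\,d\|W\|(y)\,d\rho .$$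
   Context: **Weighted flags as matrices.** $\mathcal{W}\mathcal{F}(n)$ is identified (as a topological space) with $\mathrm{Sym}_+^1(n)$, the compact set of real symmetric positive semi-definite $n\times n$ matrices of trace $1$. For $S\in\mathrm{Sym}_+^1(n)$ let $\lambda_1(S)\ge\dots\ge\lambda_n(S)\ge0$ be its ordered eigenvalues, $\lambda_{n+1}(S)=0$, $\mu_k(S)=k(\lambda_k(S)-\lambda_{k+1}(S))\ge0$ (so $\sum_k\mu_k(S)=1$), $F_k(S)$ the eigenspace of $\lambda_k(S)$ and $E_k(S)=F_1(S)+\dots+F_k(S)$ (of dimension $k$ whenever $\mu_k(S)>0$). $\Pi_E$ denotes orthogonal projection onto $E$. Put $$\overline S=\sum_{k=1}^n\mu_k(S)\Pi_{E_k(S)},\quad\overline S^\perp=I_n-\overline S,\quad\overline d(S)=\mathrm{tr}\,\overline S=\sum_{k=1}^nk\mu_k(S).$$ **Flagfolds.** A flagfold in $\Omega$ is a (nonnegative) Radon measure $W$ on $\Omega\times\mathcal{W}\mathcal{F}(n)$. Its mass is the Radon measure $\|W\|(B)=W(B\times\mathcal{W}\mathcal{F}(n))$ on $\Omega$. By disintegration, $W=\|W\|\otimes w^y$ with probability measures $w^y$ on $\mathcal{W}\mathcal{F}(n)$ defined for $\|W\|$-a.e. $y$; put $\overline d(y)=\int\overline d(S)\,dw^y(S)$. **First variation.** For $X\in C_c^1(\Omega,\mathbb{R}^n)$, $\delta W(X)=\int_{\Omega\times\mathcal{W}\mathcal{F}(n)}\mathrm{tr}(\overline S\,DX(x))\,dW(x,S)$.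 $W$ has locally bounded first variation if for every compact $K\subset\Omega$ there is $c_K>0$ with $|\delta W(X)|\le c_K\|X\|_\infty$ for all $X\in C_c^1(\Omega,\mathbb{R}^n)$ supported in $K$, i.e. $\delta W$ is (represented by) a vector Radon measure. $B_\rho(x)$ is the open ball of radius $\rho$ centred at $x$. *)

(* Defs.v *)
From HB Require Import structures.
From mathcomp Require Import all_boot all_order all_algebra.
From mathcomp Require Import all_classical all_reals all_analysis.

Set Implicit Arguments.
Unset Strict Implicit.
Unset Printing Implicit Defensive.

Import Order.TTheory GRing.Theory Num.Theory numFieldNormedType.Exports.

Local Open Scope classical_set_scope.
Local Open Scope ring_scope.

(* The norm of the library on row vectors is the sup norm, hence the explicit
   Euclidean inner product, norm, balls and distance; the topology is the
   same. *)
Section euclidean.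
Context {R : realType} {n : nat}.
Implicit Types (x y v : 'rV[R]_n) (Omega : set 'rV[R]_n).

Definition inner v y : R := (v *m y^T) 0 0.

Definition enorm v : R := Num.sqrt (inner v v).

Definition eball x (rho : R) : set 'rV[R]_n := [set y | enorm (y - x) < rho].

(* Extended-real valued, and +oo when Omega is the whole space. *)
Definition dist_compl x Omega : \bar R :=
  ereal_inf [set (enorm (x - y))%:E | y in ~` Omega].

End euclidean.

Section weighted_flags.
Context {R : realType} {n : nat}.
Implicit Types S E : 'M[R]_n.

Definition WF : set 'M[R]_n :=
  [set S | [/\ S^T = S, forall v : 'rV[R]_n, 0 <= inner (v *m S) v
             & \tr S = 1]].

(* The eigenvalues with multiplicity, in non-increasing order (such a sequence
   exists for symmetric S, and is then unique). *)
Definition eigseq S : seq R :=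
  xget [::] [set s | sorted >=%R s /\
                     char_poly S = \prod_(z <- s) ('X - z%:P)].

(* Indexed from 1 as in the paper; the default 0 of nth gives
   eigval S n.+1 = 0. *)
Definition eigval S (k : nat) : R := (eigseq S)`_k.-1.

Definition flag_mu S (k : nat) : R := k%:R * (eigval S k - eigval S k.+1).

(* Subspaces are row spaces of matrices, as in mxalgebra; S being symmetric,
   its row and column eigenspaces agree. *)
Definition flagE S (k : nat) : 'M[R]_n :=
  (\sum_(1 <= i < k.+1) eigenspace S (eigval S i))%MS.

(* The projection onto the row space of E along its orthogonal complement
   {u | u *m E^T = 0}. *)
Definition orth_proj E : 'M[R]_n := proj_mx <<E>>%MS (kermx E^T).

Definition Sbar S : 'M[R]_n :=
  \sum_(1 <= k < n.+1) flag_mu S k *: orth_proj (flagE S k).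

Definition Sbar_perp S : 'M[R]_n := 1%:M - Sbar S.

Definition dbar S : R := \tr (Sbar S).

End weighted_flags.
Arguments WF R n : clear implicits.

(* On a product the library's sigma-algebra borel T * borel U is generated by
   the rectangles; for the second-countable spaces used below it is the Borel
   sigma-algebra of T * U. *)
Definition borel (T : ptopologicalType) := g_sigma_algebraType (@open T).

Section measurability_WF.
Context {R : realType} {n : nat}.

Let cvg_sumr (I : finType) (T : topologicalType) (F : I -> T -> R) :
  (forall i, continuous (F i)) -> continuous (fun x => \sum_i F i x).
Proof. by move=> cF; apply: (@continuous_big _ _ +%R); first exact: add_continuous.
Qed.

Let continuous_quad (v : 'rV[R]_n) :
  continuous (fun S : 'M[R]_n => inner (v *m S) v).
Proof.
have -> : (fun S : 'M[R]_n => inner (v *m S) v) =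
          (fun S => \sum_i (\sum_j v 0 j * S j i) * v 0 i).
  apply/funext => S; rewrite /inner mxE; apply: eq_bigr => i _.
  by rewrite !mxE.
have cvS i : continuous (fun S : 'M[R]_n => \sum_j v 0 j * S j i).
  by apply: cvg_sumr => j S; exact: (cvgMl_tmp (@coord_continuous _ _ _ j i S)).
by apply: cvg_sumr => i S; exact: (cvgMr_tmp (@cvS i S)).
Qed.

Let continuous_trace : continuous (fun S : 'M[R]_n => \tr S).
Proof. by apply: cvg_sumr => i; exact: coord_continuous. Qed.

Let continuous_skew (i j : 'I_n) :
  continuous (fun S : 'M[R]_n => S i j - S j i).
Proof. by move=> S; exact: (cvgB (@coord_continuous _ _ _ i j S)
                          (@coord_continuous _ _ _ j i S)). Qed.

Lemma closed_WF : closed (WF R n).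
Proof.
have -> : WF R n =
  \bigcap_(ij : 'I_n * 'I_n)
     (fun S : 'M[R]_n => S ij.1 ij.2 - S ij.2 ij.1) @^-1` [set x | x = 0]
  `&` \bigcap_(v : 'rV[R]_n)
     (fun S : 'M[R]_n => inner (v *m S) v) @^-1` [set x | 0 <= x]
  `&` (fun S : 'M[R]_n => \tr S) @^-1` [set x | x = 1].
  apply/seteqP; split=> [S [sS pS tS]|S [[sS pS] tS]]; split=> //.
  - split=> [[i j] _|v _] /=; last exact: pS.
    by rewrite -[in S i j]sS mxE subrr.
  - apply/matrixP => i j; rewrite mxE.
    by have /= /eqP := sS (j, i) I; rewrite subr_eq0 => /eqP.
  - by move=> v; exact: pS.
apply: closedI; first apply: closedI.
- apply: closed_bigI => -[i j] _; apply: preimage_closed; last exact: closed_eq.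
  by move=> S _; exact: continuous_skew.
- apply: closed_bigI => v _; apply: preimage_closed; last exact: closed_ge.
  by move=> S _; exact: continuous_quad.
- apply: preimage_closed; last exact: closed_eq.
  by move=> S _; exact: continuous_trace.
Qed.

Lemma measurable_WF : measurable (WF R n : set (borel 'M[R]_n)).
Proof.
rewrite -[WF R n]setCK; apply: measurableC; apply: sub_sigma_algebra.
exact/closed_openC/closed_WF.
Qed.

End measurability_WF.

Local Open Scope ereal_scope.

Section flagfolds.
Context {R : realType} {n : nat}.
Implicit Types (Omega : set 'rV[R]_n)
  (W : {measure set (borel 'rV[R]_n * borel 'M[R]_n) -> \bar R}).

(* Radon measures on the locally closed sets Omega and Omega x WF(n) are
   encoded as Borel measures on the ambient space which vanish off the set and
   are finite on its compact subsets; regularity is automatic. *)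
Definition radon_in Omega (m : {measure set (borel 'rV[R]_n) -> \bar R}) :=
  m (~` Omega) = 0 /\
  forall K : set 'rV[R]_n, compact K -> K `<=` Omega -> m K < +oo.

Definition flagfold Omega W :=
  W (~` (Omega `*` WF R n)) = 0 /\
  forall K : set ('rV[R]_n * 'M[R]_n),
    compact K -> K `<=` Omega `*` WF R n -> W K < +oo.

Definition mass W (B : set (borel 'rV[R]_n)) : \bar R := W (B `*` WF R n).

Section mass_measure.
Variable W : {measure set (borel 'rV[R]_n * borel 'M[R]_n) -> \bar R}.

Let mass0 : mass W set0 = 0.
Proof. by rewrite /mass set0X measure0. Qed.

Let mass_ge0 B : 0 <= mass W B.
Proof. exact: measure_ge0. Qed.

Let mass_sigma_additive : semi_sigma_additive (mass W).
Proof.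
move=> F mF tF mUF; rewrite /mass.
rewrite [X in _ --> W X](_ : _ = \bigcup_k (F k `*` WF R n)); last first.
  apply/seteqP; split=> [[y S] [[k _ Fky] wS]|[y S] [k _ [Fky wS]]].
    by exists k.
  by split=> //; exists k.
apply: measure_semi_sigma_additive.
- by move=> k; apply: measurableX => //; exact: measurable_WF.
- apply/trivIsetP => i j _ _ ij; apply/seteqP; split=> // -[y S] [[Fi _] [Fj _]].
  have /trivIsetP/(_ i j I I ij) Fij := tF.
  by have : (F i `&` F j) y by []; rewrite Fij.
- by apply: bigcup_measurable => k _; apply: measurableX => //;
    exact: measurable_WF.
Qed.

HB.instance Definition _ := isMeasure.Build _ _ _ (mass W)
  mass0 mass_ge0 mass_sigma_additive.

End mass_measure.

(* W = ||W|| (x) w^y.  The probability w^y is only determined for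
   ||W||-almost every y, on the other y it is arbitrary. *)
Definition disintegration W
    (w : R.-pker (borel 'rV[R]_n) ~> (borel 'M[R]_n)) :=
  {ae mass W, forall y, w y (~` WF R n) = 0} /\
  forall A, measurable A -> W A = \int[mass W]_y w y (xsection A y).

Definition mean_dbar (w : R.-pker (borel 'rV[R]_n) ~> (borel 'M[R]_n))
    (y : 'rV[R]_n) : \bar R :=
  \int[w y]_(S in WF R n) (dbar S)%:E.

End flagfolds.

Section first_variation.
Context {R : realType} {n : nat}.
Implicit Types (Omega K : set 'rV[R]_n) (X : 'rV[R]_n -> 'rV[R]_n)
  (W : {measure set (borel 'rV[R]_n * borel 'M[R]_n) -> \bar R}).

Definition supp X : set 'rV[R]_n := closure [set y | X y != 0%R].

(* C_c^1(Omega, R^n), the fields being extended by zero outside Omega. *)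
Definition C1c Omega X :=
  [/\ forall y, differentiable X y,
      continuous (fun y => 'J X y : 'M[R]_n),
      compact (supp X) & supp X `<=` Omega].

Definition sup_norm X : R := sup [set enorm (X y) | y in setT].

(* 'J X y acts on row vectors, so that DX(y) is its transpose. *)
Definition first_variation Omega W X : \bar R :=
  \int[W]_(p in Omega `*` WF R n) (\tr (Sbar p.2 *m ('J X p.1)^T))%:E.

Definition locally_bounded_first_variation Omega W :=
  forall K, compact K -> K `<=` Omega ->
  exists2 c : R, (0 < c)%R &
    forall X, C1c Omega X -> supp X `<=` K ->
      `|first_variation Omega W X| <= (c * sup_norm X)%:E.

(* A vector Radon measure in Omega: each component is a difference of two Radon
   measures, hence a real number on Borel sets relatively compact in Omega. *)
Record vector_radon Omega := VectorRadon {
  vr_pos : 'I_n -> {measure set (borel 'rV[R]_n) -> \bar R} ;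
  vr_neg : 'I_n -> {measure set (borel 'rV[R]_n) -> \bar R} ;
  vr_posP : forall i, radon_in Omega (vr_pos i) ;
  vr_negP : forall i, radon_in Omega (vr_neg i) }.

Definition vr_val Omega (m : vector_radon Omega) (B : set (borel 'rV[R]_n)) :
    'rV[R]_n :=
  \row_i (fine (vr_pos m i B) - fine (vr_neg m i B))%R.

Definition vr_integral Omega (m : vector_radon Omega) X : \bar R :=
  \sum_(i < n) (\int[vr_pos m i]_(y in Omega) (X y 0 i)%:E -
                \int[vr_neg m i]_(y in Omega) (X y 0 i)%:E).

(* |m|(B), for B relatively compact in Omega. *)
Definition vr_variation Omega (m : vector_radon Omega)
    (B : set (borel 'rV[R]_n)) : \bar R :=
  ereal_sup [set \sum_(0 <= j <oo) (enorm (vr_val m (F j)))%:E | F in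
    [set F : (set (borel 'rV[R]_n))^nat |
      [/\ forall j, measurable (F j), trivIset setT F & \bigcup_j F j = B]]].

Definition represents_first_variation Omega W (m : vector_radon Omega) :=
  forall X, C1c Omega X -> first_variation Omega W X = vr_integral m X.

End first_variation.

(* Main.v *)
From HB Require Import structures.
Require Import Defs.
From mathcomp Require Import all_boot all_order all_algebra.
From mathcomp Require Import all_classical all_reals all_analysis.
From mathcomp Require Import measurable_realfun.
From mathcomp Require Import complex.
From mathcomp Require Import ring lra.

(** Monotonicity and the stationary identity are two readings of one identity,
    obtained by testing the first variation against radial fields.

    Let r = |y - x|, let psi be a continuous weight on the radii, supported in
    an interval [a, xi] with a > 0, and let phi(r) be the integral of psi over
    [r, xi].  The field X(y) = phi(r) (y - x) has the derivative
    phi(r) I - (psi(r) / r) (y - x)^T (y - x), so that delta W (X) is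
      int phi(r) dbar(S) dW - int (psi(r) / r) (Sbar (y - x)).(y - x) dW.
    Since phi(r) is the integral of psi(s) over the radii s > r, exchanging the
    integrals ([layer_cake_lebesgue]) turns this into
      int psi(s) G(s) ds
        = int psi(s) A(s) ds - int (psi(r) / r) (Sbar (y - x)).(y - x) dW,
    where A(s) is the integral of dbar over B_s ([ball_dbar]) and G(s) the
    integral of y - x against delta W over B_s ([ball_flux]); this is
    [radial_identity_continuous].  No derivative of psi is left, so dominated
    convergence extends it to psi = g 1_[sigma, xi[ with g continuous
    ([radial_identity]).  The mass m(s) of B_s is never differentiated.

    Take g(s) = exp(Lambda s) s^(-d-1) and h(s) = exp(Lambda s) s^(-d), so that
    - h'(s) = g(s) (d - Lambda s).  The same exchange of integrals gives
      int_sigma^xi (- h') m ds = h(sigma) m(sigma) - h(xi) m(xi)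
                                 + int_{sigma <= r < xi} h(r) d||W||
    ([mass_by_parts]).  For the monotonicity, A >= d m by hypothesis,
    |G(s)| <= s |delta W|(B_s) <= Lambda s m(s) ([ball_flux_le]), and Sbar <= I;
    hence the left-hand side is at most int g (A - G), which equals the integral
    of (g(r) / r) (Sbar (y - x)).(y - x) over sigma <= r < xi, at most that of
    g(r) r = h(r); what remains is h(sigma) m(sigma) <= h(xi) m(xi)
    ([density_ratio_le]).  If delta W = 0, then G = 0, and for Lambda = 0 the two
    identities combine into the formula of the theorem ([stationary_identity]).

    The integrals make sense because Sbar is a measurable function of S with
    0 <= Sbar <= I on the weighted flags.  If S has eigenvalues d_i in an
    orthonormal basis, then Sbar has the eigenvalues sum_k min(d_k, d_i) in the
    same basis ([Sbar_spectral]).  As min(a, b) = (a + b - |a - b|) / 2 and |t|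
    is a limit of polynomials q_m, Sbar is a limit of expressions in
    sum_k q_m(S - d_k I), which is a polynomial in the entries of S: by the
    binomial formula it only involves the powers of S and their traces
    ([Sbar_cvg], [measurable_Sbar]). *)

Set Implicit Arguments.
Unset Strict Implicit.
Unset Printing Implicit Defensive.

Import Order.TTheory GRing.Theory Num.Theory numFieldNormedType.Exports.

Local Open Scope classical_set_scope.
Local Open Scope ring_scope.

(** * Diagonalisation of real symmetric matrices *)

Section spectral.
Context {R : realType}.

(** Over the complex numbers S is Hermitian, so its eigenvalues are real, and a
    real root of the complex characteristic polynomial is a root of the real
    one. *)
Lemma symmetric_eigenvalue n (S : 'M[R]_n.+1) : S^T = S ->
  exists a, eigenvalue S a.
Proof.
move=> sS; pose toC := real_complex R; pose Sc := map_mx toC S.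
have Sc_real : Sc \is a realmx.
  by apply/mxOverP => i j; rewrite mxE complex_real.
have Sc_herm : Sc \is hermsymmx.
  apply: realsym_hermsym => //; apply/is_hermitianmxP.
  by rewrite expr0 scale1r map_mx_id// map_trmx sS.
have /orthomx_spectralP SE := hermitian_normalmx Sc_herm.
have /mxOverP/(_ 0 0) /complex_realP [a aE] := hermitian_spectral_diag_real Sc_herm.
exists a; rewrite eigenvalue_root_char -(fmorph_root toC) map_char_poly.
rewrite -eigenvalue_root_char -/Sc.
have Uunit := spectral_unit Sc.
move: (spectralmx Sc) (spectral_diag Sc) Uunit SE aE => U D Uunit -> aE.
apply/eigenvalueP; exists (row 0 U).
  rewrite rowE -!mulmxA (mulmxA U) mulmxV// mul1mx mulmxA -(rowE 0 (diag_mx D)) row_diag_mx aE.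
  by rewrite -scalemxAl.
apply/eqP => /(congr1 (mulmx^~ (invmx U))).
rewrite rowE mul0mx mulmxK// => /rowP/(_ 0).
by rewrite !mxE !eqxx => /eqP; rewrite oner_eq0.
Qed.

Lemma innerE n (u v : 'rV[R]_n) : inner u v = \sum_i u 0 i * v 0 i.
Proof. by rewrite /inner mxE; apply: eq_bigr => i _; rewrite mxE. Qed.

Lemma innerC n (u v : 'rV[R]_n) : inner u v = inner v u.
Proof. by rewrite !innerE; apply: eq_bigr => i _; rewrite mulrC. Qed.

Lemma inner_ge0 n (u : 'rV[R]_n) : 0 <= inner u u.
Proof. by rewrite innerE; apply: sumr_ge0 => i _; rewrite -expr2 sqr_ge0. Qed.

Lemma inner_eq0 n (u : 'rV[R]_n) : (inner u u == 0) = (u == 0).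
Proof.
apply/eqP/eqP => [|->]; last by rewrite /inner mul0mx mxE.
rewrite innerE => /psumr_eq0P h; apply/rowP => i; rewrite mxE.
have /eqP := h (fun i _ => sqr_ge0 (u 0 i)) i isT.
by rewrite sqrf_eq0 => /eqP.
Qed.

Lemma mul_rV_tr n (u v : 'rV[R]_n) : u *m v^T = (inner u v)%:M.
Proof. by apply/matrixP => i j; rewrite !ord1 /inner [RHS]mxE eqxx mulr1n. Qed.

(** The reflection in the hyperplane orthogonal to v - e_0 exchanges e_0 and v. *)
Lemma householder n (v : 'rV[R]_n.+1) : inner v v = 1 ->
  exists H : 'M[R]_n.+1, [/\ H^T = H, H *m H = 1%:M & delta_mx 0 0 *m H = v].
Proof.
move=> v1; pose e : 'rV[R]_n.+1 := delta_mx 0 0; pose w := v - e.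
have [w0|w0] := eqVneq w 0.
  exists 1%:M; split; rewrite ?trmx1 ?mulmx1//.
  by apply/esym/eqP; rewrite -subr_eq0; apply/eqP.
have ee : inner e e = 1.
  by rewrite /inner trmx_delta mul_delta_mx mxE eqxx.
have wD : inner w w = 2 - 2 * inner v e.
  rewrite /w {1}/inner linearB /= mulmxBr !mulmxBl !mul_rV_tr !mxE eqxx !mulr1n.
  by rewrite v1 ee (innerC e v); ring.
have ew : inner e w = inner v e - 1.
  rewrite /w {1}/inner linearB /= mulmxBr !mul_rV_tr !mxE eqxx !mulr1n.
  by rewrite ee (innerC e v).
have ww0 : inner w w != 0 by rewrite inner_eq0.
pose c := 2 / inner w w.
exists (1%:M - c *: (w^T *m w)); split.
- by rewrite linearB /= trmx1 linearZ /= trmx_mul trmxK.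
- have AA : (c *: (w^T *m w)) *m (c *: (w^T *m w)) = c *: (w^T *m w) + c *: (w^T *m w).
    rewrite -scalemxAr -scalemxAl -mulmxA (mulmxA w) mul_rV_tr mul_scalar_mx.
    rewrite -scalemxAr !scalerA -scalerDl; congr (_ *: _); rewrite /c; field.
    exact: ww0.
  rewrite mulmxBr mulmx1 mulmxBl mul1mx AA.
  by rewrite opprB addrK subrK.
- rewrite -/e mulmxBr mulmx1 -scalemxAr mulmxA mul_rV_tr mul_scalar_mx scalerA.
  have -> : c * inner e w = - 1.
    have := ew; rewrite /c => ->.
    have : inner v e - 1 = - inner w w / 2 by rewrite wD; field.
    by move=> ->; field.
  by rewrite scaleN1r opprK /w addrC subrK.
Qed.

(** Induction on the size: a reflection taking e_0 to a unit eigenvector makes S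
    block diagonal, symmetry killing the off-diagonal blocks. *)
Lemma symmetric_spectral n (S : 'M[R]_n) : S^T = S ->
  exists (P : 'M[R]_n) (d : 'rV[R]_n),
    P *m P^T = 1%:M /\ S = P^T *m diag_mx d *m P.
Proof.
elim: n S => [|n IH] S sS.
  by exists 1%:M, 0; split; apply/matrixP => -[].
have [a /eigenvalueP [v0 v0S v0n0]] := symmetric_eigenvalue sS.
pose v := (Num.sqrt (inner v0 v0))^-1 *: v0.
have v1 : inner v v = 1.
  rewrite /inner /v linearZ /= -scalemxAr -scalemxAl mul_rV_tr !mxE eqxx mulr1n.
  rewrite mulrA -expr2 exprVn sqr_sqrtr ?inner_ge0// mulVf//.
  by rewrite inner_eq0.
have vS : v *m S = a *: v by rewrite -scalemxAl v0S !scalerA mulrC.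
have [H [sH HH eH]] := householder v1.
pose T := H *m S *m H : 'M[R]_(1 + n).
have sT : T^T = T by rewrite !trmx_mul sH sS mulmxA.
have eT : delta_mx 0 0 *m T = a *: (delta_mx 0 0 : 'rV_(1 + n)).
  by rewrite /T !mulmxA eH vS -scalemxAl -eH -mulmxA HH mulmx1.
have TD : H *m S *m H = T by [].
clearbody T.
have T0 j : T 0 j = a *+ (j == 0).
  by move: eT; rewrite -rowE => /rowP/(_ j); rewrite !mxE eqxx /= mulr_natr.
have [P' [d' [PP' SE']]] : exists (P' : 'M[R]_n) (d' : 'rV[R]_n),
    P' *m P'^T = 1%:M /\ drsubmx T = P'^T *m diag_mx d' *m P'.
  by apply: IH; rewrite trmx_drsub sT.
have l0 : lshift n (0 : 'I_1) = 0 :> 'I_n.+1 by apply: ord_inj.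
have TE : T = block_mx a%:M 0 0 (drsubmx T).
  rewrite -{1}(submxK T); congr block_mx.
  - apply/matrixP => i j; rewrite !ord1 !mxE.
    by have := T0 (lshift n 0); rewrite -l0 eqxx => ->.
  - apply/matrixP => i j; rewrite !ord1 !mxE.
    by have := T0 (rshift 1 j); rewrite -l0.
  - apply/matrixP => i j; rewrite !ord1 -sT !mxE.
    by have := T0 (rshift 1 i); rewrite -l0.
pose Q : 'M[R]_(1 + n) := block_mx 1%:M 0 0 P'.
have QQ : Q *m Q^T = 1%:M.
  rewrite /Q tr_block_mx !trmx0 trmx1.
  rewrite mulmx_block !mulmx0 !mul0mx mulmx1 !addr0 !add0r PP'.
  by rewrite -scalar_mx_block.
have TQ : T = Q^T *m diag_mx (row_mx a%:M d') *m Q.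
  rewrite TE SE' diag_mx_row /Q tr_block_mx !trmx0 trmx1 !mulmx_block.
  rewrite !mulmx0 !mul0mx !mulmx1 !mul1mx !addr0 !add0r ?mulmx0 ?mul0mx ?addr0.
  congr block_mx; apply/matrixP => i j; rewrite !ord1 !mxE.
  by rewrite eqxx !mulr1n.
exists (Q *m H), (row_mx a%:M d' : 'rV[R]_(1 + n)); split.
  by rewrite trmx_mul sH mulmxA -(mulmxA Q) HH mulmx1.
have -> : S = H *m T *m H by rewrite -TD !mulmxA HH mul1mx -mulmxA HH mulmx1.
by rewrite trmx_mul sH TQ !mulmxA.
Qed.

End spectral.

(** * The matrix Sbar in an eigenbasis *)

Lemma perm_eq_prod_XsubC (F : idomainType) (s t : seq F) :
  \prod_(z <- s) ('X - z%:P) = \prod_(z <- t) ('X - z%:P) -> perm_eq s t.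
Proof.
elim: s t => [|a s IH] t st.
  rewrite big_nil in st; case: t st => // b t /(congr1 (root^~ b)).
  by rewrite big_cons rootM root_XsubC eqxx (negPf (root1 b)).
have at_ : a \in t by rewrite -root_prod_XsubC -st root_prod_XsubC mem_head.
rewrite perm_sym; apply: (perm_trans (perm_to_rem at_)).
rewrite perm_cons perm_sym; apply: IH.
move: st; rewrite (perm_big _ (perm_to_rem at_)) !big_cons/=.
by apply: mulfI; rewrite polyXsubC_eq0.
Qed.

Section weighted_projection.
Context {R : realType} {n : nat}.
Implicit Types (S P : 'M[R]_n) (d r : 'rV[R]_n).

Lemma char_poly_spectral P d : P *m P^T = 1%:M ->
  char_poly (P^T *m diag_mx d *m P) = \prod_i ('X - (d 0 i)%:P).
Proof.
move=> PP; have PP' := mulmx1C PP.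
have PCC : map_mx polyC P^T *m map_mx polyC P = 1%:M.
  by rewrite -map_mxM PP' map_scalar_mx.
rewrite /char_poly /char_poly_mx.
have -> : 'X%:M - map_mx polyC (P^T *m diag_mx d *m P) =
   map_mx polyC P^T *m ('X%:M - map_mx polyC (diag_mx d)) *m map_mx polyC P.
  rewrite !map_mxM mulmxBr mulmxBl; congr (_ - _).
  by rewrite -mulmxA mul_scalar_mx -scalemxAr PCC scalemx1.
rewrite !det_mulmx mulrAC -det_mulmx PCC det1 mul1r map_diag_mx.
have -> : 'X%:M - diag_mx (map_mx polyC d) = diag_mx (\row_i ('X - (d 0 i)%:P)).
  apply/matrixP => i j; rewrite !mxE; case: eqVneq => [->|_] /=; rewrite ?mulr1n ?mulr0n//.
  by rewrite subr0.
by rewrite det_diag; apply: eq_bigr => i _; rewrite mxE.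
Qed.

Definition sorted_spectrum d : seq R := sort >=%R [seq d 0 i | i <- enum 'I_n].

Lemma eigseq_spectral P d : P *m P^T = 1%:M ->
  eigseq (P^T *m diag_mx d *m P) = sorted_spectrum d.
Proof.
move=> PP; rewrite /eigseq.
have chE : char_poly (P^T *m diag_mx d *m P) =
    \prod_(z <- sorted_spectrum d) ('X - z%:P).
  rewrite char_poly_spectral// (perm_big _ (permEl (perm_sort _ _)))/=.
  by rewrite big_map big_enum.
case: xgetP => [s _ [ss sE]|/(_ (sorted_spectrum d))]; last first.
  by case; split=> //; apply: sort_sorted => a b; exact: le_total.
apply: (@sorted_eq _ >=%R) => //.
- by move=> b a c ab bc; exact: le_trans bc ab.
- by move=> a b /andP[ab ba]; apply/le_anti/andP.
- by apply: sort_sorted => a b; exact: le_total.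
- by apply: perm_eq_prod_XsubC; rewrite -sE -chE.
Qed.

Lemma size_sorted_spectrum d : size (sorted_spectrum d) = n.
Proof. by rewrite size_sort size_map size_enum_ord. Qed.

Lemma sorted_spectrum_ge d i j : (i <= j < n)%N ->
  (sorted_spectrum d)`_j <= (sorted_spectrum d)`_i.
Proof.
move=> /andP[ij jn].
have st : sorted >=%R (sorted_spectrum d).
  by apply: sort_sorted => a b; exact: le_total.
have tr : transitive (>=%R : rel R) by move=> b a c ab bc; exact: le_trans bc ab.
have re : reflexive (>=%R : rel R) by move=> a; exact: lexx.
apply: (sorted_leq_nth tr re 0 st) => //.
- by rewrite inE size_sorted_spectrum (leq_ltn_trans ij).
- by rewrite inE size_sorted_spectrum.
Qed.

Lemma mem_sorted_spectrum d i : d 0 i \in sorted_spectrum d.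
Proof. by rewrite mem_sort; apply: map_f; rewrite mem_enum. Qed.

(** A symmetric idempotent Q splits 1 as Q + (1 - Q), and the row space of
    1 - Q is the orthogonal complement of that of Q. *)
Lemma orth_projE (E Q : 'M[R]_n) :
  (E :=: Q)%MS -> Q^T = Q -> Q *m Q = Q -> orth_proj E = Q.
Proof.
move=> EQ sQ QQ; rewrite /orth_proj.
have dis : (<<E>> :&: kermx E^T)%MS = 0.
  apply/eqP; rewrite -submx0; apply/rV_subP => u; rewrite sub_capmx.
  move=> /andP[]; rewrite genmxE EQ => /submxP[a ->] /sub_kermxP uE.
  have /submxP[b QE] : (Q <= E)%MS by rewrite EQ.
  have := congr1 (mulmx^~ b^T) uE; rewrite mul0mx -mulmxA -trmx_mul -QE sQ.
  by rewrite -mulmxA QQ => ->; exact: sub0mx.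
have Qs : (Q <= <<E>>)%MS by rewrite genmxE EQ.
have Qk : ((1%:M - Q) <= kermx E^T)%MS.
  apply/sub_kermxP; have /submxP[b ->] : (E <= Q)%MS by rewrite EQ.
  by rewrite trmx_mul sQ mulmxA mulmxBl mul1mx QQ subrr mul0mx.
rewrite -[LHS]mul1mx -[1%:M](subrK Q) mulmxDl (proj_mx_0 dis Qk) add0r.
exact: proj_mx_id.
Qed.

(** Every eigenvector for one of the k largest eigenvalues only has components
    along the basis vectors whose eigenvalue is at least the k-th one, and each
    of these eigenvalues is among the k largest. *)
Lemma flagE_spectral P d k : P *m P^T = 1%:M -> (0 < k <= n)%N ->
  (flagE (P^T *m diag_mx d *m P) k :=:
   P^T *m diag_mx (\row_i ((sorted_spectrum d)`_k.-1 <= d 0 i)%R%:R) *m P)%MS.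
Proof.
move=> PP /andP[k0 kn]; set S := _ *m P; set r := \row_i _.
have PP' := mulmx1C PP.
apply/eqmxP/andP; split.
  rewrite /flagE big_nat; apply: (big_ind (fun A => (A <= _)%MS)).
  - exact: sub0mx.
  - by move=> A B A1 B1; rewrite addsmx_sub A1.
  move=> i /andP[i0 ik].
  rewrite {1}/eigval eigseq_spectral//; set l := _`_ _.
  set A := eigenspace _ _; have /eigenspaceP AS : (A <= eigenspace S l)%MS by [].
  clearbody A; pose B := A *m P^T.
  have AB : A = B *m P by rewrite /B -mulmxA PP' mulmx1.
  have BD : B *m diag_mx d = l *: B.
    have := congr1 (mulmx^~ P^T) AS; rewrite {1}AB /S -!mulmxA PP mulmx1.
    by rewrite (mulmxA P) PP mul1mx -scalemxAl.
  have BE : B = A *m P^T by [].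
  clearbody B; have Br : B *m diag_mx r = B.
    apply/matrixP => u j; have /matrixP/(_ u j) := BD.
    rewrite !mul_mx_diag !mxE => Bu.
    have [dl|/negPf dl] := boolP (d 0 j == l); last first.
      have /eqP : B u j * (d 0 j - l) = 0 by rewrite mulrBr Bu mulrC subrr.
      by rewrite mulf_eq0 subr_eq0 dl orbF => /eqP ->; rewrite mul0r.
    rewrite (eqP dl) /l sorted_spectrum_ge ?mulr1//.
    by rewrite -!subn1 leq_sub2r//= -(prednK k0) subn1 /= prednK.
  by rewrite AB -Br BE -!mulmxA; exact: submxMl.
rewrite -mulmxA; apply: (submx_trans (submxMl _ _)); apply/row_subP => i.
rewrite row_mul row_diag_mx -scalemxAl -rowE mxE; case: (boolP (_ <= d 0 i)) => [di|]; last by rewrite scale0r sub0mx.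
rewrite scale1r.
have rS : row i P *m S = d 0 i *: row i P.
  rewrite /S rowE -!mulmxA (mulmxA P) PP mul1mx mulmxA -(rowE i (diag_mx d)).
  by rewrite row_diag_mx -scalemxAl.
pose m := index (d 0 i) (sorted_spectrum d).
have mn : (m < n)%N by rewrite -(size_sorted_spectrum d) index_mem mem_sorted_spectrum.
have dm : (sorted_spectrum d)`_m = d 0 i by rewrite nth_index// mem_sorted_spectrum.
(* the minimum spares the proof that the first occurrence m is below k *)
pose m' := minn m k.-1.
have m'k : (0 < m'.+1 < k.+1)%N by rewrite /m' /= ltnS -{2}(prednK k0) ltnS geq_minr.
have dm' : (sorted_spectrum d)`_m' = d 0 i.
  rewrite /m' /minn; case: ltnP => // km; apply/eqP; rewrite eq_le di /= -dm.
  by rewrite sorted_spectrum_ge// km mn.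
rewrite /flagE (bigD1_seq m'.+1) ?mem_index_iota ?iota_uniq//=.
apply: (submx_trans _ (addsmxSl _ _)).
by apply/eigenspaceP; rewrite /eigval eigseq_spectral//= dm'.
Qed.

(** Summation by parts. *)
Lemma abel_sum (u : nat -> R) m :
  \sum_(1 <= k < m.+1) k%:R * (u k.-1 - u k) = \sum_(k < m) u k - m%:R * u m.
Proof.
elim: m => [|m IH]; first by rewrite big_geq// big_ord0 mul0r subrr.
by rewrite big_nat_recr//= IH big_ord_recr/= -natr1; ring.
Qed.

(** On the eigenvector for t = d_i, the projection on E_k acts as 1 when
    L_k <= t and as 0 otherwise, so Sbar acts as the sum over k of
    k (L_k - L_k.+1) [L_k <= t].  As t is one of the L_j, this is the sum of
    k (u_k - u_k.+1) with u_k = min(L_k, t), and summation by parts gives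
    sum_k u_k. *)
Lemma Sbar_spectral P d : P *m P^T = 1%:M -> (forall i, 0 <= d 0 i) ->
  Sbar (P^T *m diag_mx d *m P) =
  P^T *m diag_mx (\row_i \sum_k Num.min (d 0 k) (d 0 i)) *m P.
Proof.
move=> PP d0; set L := sorted_spectrum d.
have PP' := mulmx1C PP.
pose r k : 'rV[R]_n := \row_i (L`_k.-1 <= d 0 i)%R%:R.
have projE k : (0 < k <= n)%N ->
    orth_proj (flagE (P^T *m diag_mx d *m P) k) = P^T *m diag_mx (r k) *m P.
  move=> kn; apply: orth_projE; first exact: flagE_spectral.
    by rewrite !trmx_mul trmxK tr_diag_mx mulmxA.
  rewrite -!mulmxA (mulmxA P) PP mul1mx; congr (_ *m _); rewrite mulmxA.
  congr (_ *m _); apply/matrixP => i j; rewrite mul_diag_mx !mxE.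
  by case: (_ <= _); rewrite ?mul0r ?mul1r ?mul0rn.
rewrite /Sbar.
transitivity (\sum_(1 <= k < n.+1)
    (k%:R * (L`_k.-1 - L`_k)) *: (P^T *m diag_mx (r k) *m P)).
  rewrite big_nat [RHS]big_nat; apply: eq_bigr => k /andP[k0 kn].
  by rewrite projE ?k0// /flag_mu /eigval eigseq_spectral//=.
transitivity (P^T *m diag_mx (\sum_(1 <= k < n.+1)
   (k%:R * (L`_k.-1 - L`_k)) *: r k) *m P).
  rewrite linear_sum /= mulmx_sumr mulmx_suml; apply: eq_bigr => k _.
  by rewrite linearZ /= -scalemxAr -scalemxAl.
congr (_ *m diag_mx _ *m _); apply/rowP => i; rewrite summxE !mxE.
set t := d 0 i.
have L0 k : 0 <= L`_k.
  have [kn|kn] := ltnP k (size L); last by rewrite nth_default.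
  have := mem_nth 0 kn; rewrite mem_sort => /mapP[j _ ->]; exact: d0.
transitivity (\sum_(1 <= k < n.+1)
    (k%:R * (Num.min L`_k.-1 t - Num.min L`_k t))).
  rewrite big_nat [RHS]big_nat; apply: eq_bigr => k /andP[k0 kn].
  rewrite !mxE -mulrA; congr (_ * _).
  have [Lt|tL] := leP L`_k.-1 t; rewrite ?mulr1 ?mulr0.
    case: leP => // tL; exfalso; move: tL; rewrite ltNge => /negP; apply.
    apply: le_trans Lt; have [kn'|kn'] := ltnP k n.
      by rewrite sorted_spectrum_ge// leq_pred.
    by rewrite (@nth_default _ _ _ k) ?size_sorted_spectrum.
  case: leP => // Lt; last by rewrite subrr.
  pose m := index t L.
  have mn : (m < n)%N by rewrite -(size_sorted_spectrum d) index_mem mem_sorted_spectrum.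
  have dm : L`_m = t by rewrite nth_index// mem_sorted_spectrum.
  have km : (k <= m)%N.
    rewrite leqNgt; apply/negP => mk; move: tL; rewrite ltNge => /negP; apply.
    by rewrite -dm sorted_spectrum_ge// -ltnS prednK// mk.
  have : t <= L`_k by rewrite -dm sorted_spectrum_ge// km.
  by move=> tk; apply/esym/eqP; rewrite subr_eq0 eq_le tk Lt.
rewrite (abel_sum (fun k => Num.min L`_k t)) [L`_n]nth_default ?size_sorted_spectrum//.
rewrite (min_idPl (d0 i)) mulr0 subr0.
rewrite -(big_mkord xpredT (fun k => Num.min L`_k t)).
transitivity (\sum_(z <- L) Num.min z t).
  by rewrite [RHS](big_nth 0) size_sorted_spectrum.
rewrite (perm_big _ (permEl (perm_sort _ _)))/= big_map big_enum.
by apply: eq_bigr.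
Qed.

End weighted_projection.

(** * Measurability and bounds for Sbar *)

Lemma cvg_sumr (R : realType) (T : Type) (F : set_system T) (I : finType)
    (f : I -> T -> R) (l : I -> R) : Filter F ->
  (forall i, f i x @[x --> F] --> l i) ->
  \sum_i f i x @[x --> F] --> \sum_i l i.
Proof. by move=> FF fl; apply: cvg_big => //; exact: add_continuous. Qed.

Section abs_poly.
Context {R : realType}.

(** Fixed-point iteration for the nonnegative root of q^2 = t^2, increasing to
    |t| on [-1, 1]. *)
Fixpoint abs_poly (m : nat) : {poly R} :=
  if m is k.+1 then abs_poly k + 2^-1 *: ('X^2 - abs_poly k ^+ 2) else 0.

(** The error e_m = |t| - q_m satisfies e_m.+1 = e_m (1 - (|t| + q_m) / 2), hence
    decays at least geometrically with ratio 1 - |t| / 2. *)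
Lemma cvg_abs_poly (t : R) : `|t| <= 1 ->
  (abs_poly m).[t] @[m --> \oo] --> `|t|.
Proof.
move=> t1.
have H m : 0 <= `|t| - (abs_poly m).[t] <= `|t| * (1 - `|t| / 2) ^+ m
    /\ 0 <= (abs_poly m).[t].
  elim: m => [|m [/andP[IH1 IH2] IH3]]; first by rewrite /= horner0 subr0 mulr1 lexx normr_ge0.
  rewrite /= !hornerE.
  set q := (abs_poly m).[t] in IH1 IH2 IH3 *.
  have t2 : t ^+ 2 = `|t| ^+ 2 by rewrite real_normK ?num_real.
  rewrite t2; have t0 := normr_ge0 t; move: `|t| t0 t1 IH1 IH2 => s s0 s1 IH1 IH2.
  have -> : s - (q + 2^-1 * (s ^+ 2 - q ^+ 2)) = (s - q) * (1 - (s + q) / 2).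
    by field.
  split; last first.
    by apply: addr_ge0 => //; apply: mulr_ge0; [lra|rewrite subr_sqr mulr_ge0//; lra].
  apply/andP; split; first by apply: mulr_ge0 => //; lra.
  rewrite exprSr mulrA; apply: ler_pM => //; lra.
apply: (@squeeze_cvgr _ _ _ _ (fun m => `|t| - `|t| * (1 - `|t| / 2) ^+ m) (fun=> `|t|)).
- by near=> m; have [/andP[h1 h2] h3] := H m; apply/andP; split; lra.
- rewrite -[X in _ --> X]subr0; apply: cvgB; first exact: cvg_cst.
  have [->|t0] := eqVneq `|t| 0.
    by under eq_fun do rewrite mul0r; exact: cvg_cst.
  rewrite -(mulr0 `|t|); apply: cvgMl_tmp; apply: cvg_expr.
  have : 0 < `|t| by rewrite lt_neqAle eq_sym t0 normr_ge0.
  by move=> t0'; rewrite ger0_norm; lra.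
- exact: cvg_cst.
Unshelve. all: by end_near. Qed.

End abs_poly.

Section WF_bounds.
Context {R : realType} {n : nat}.
Implicit Types S P : 'M[R]_n.

(** The eigenvalues are nonnegative because S is positive semi-definite, and add
    up to the trace. *)
Lemma WF_spectral S : WF R n S -> exists P d,
  [/\ P *m P^T = 1%:M, S = P^T *m diag_mx d *m P,
      forall i, 0 <= d 0 i & \sum_i d 0 i = 1].
Proof.
move=> [sS S0 trS]; have [P [d [PP SE]]] := symmetric_spectral sS.
have PP' := mulmx1C PP.
exists P, d; split=> // [i|]; last first.
  by rewrite -mxtrace_diag -trS SE mxtrace_mulC mulmxA PP mul1mx.
have := S0 (row i P); rewrite SE rowE !mulmxA -(mulmxA _ P) PP mulmx1.
rewrite -rowE row_diag_mx -scalemxAl -rowE /inner rowE trmx_mul -scalemxAl.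
rewrite mulmxA -(mulmxA _ P) PP mulmx1 trmx_delta mul_delta_mx !mxE.
by rewrite !eqxx mulr1.
Qed.

Lemma inner_spectral P (c : 'rV[R]_n) (v : 'rV[R]_n) :
  inner (v *m (P^T *m diag_mx c *m P)) v =
  \sum_i c 0 i * (v *m P^T) 0 i ^+ 2.
Proof.
rewrite /inner -!mulmxA (_ : P *m v^T = (v *m P^T)^T); last first.
  by rewrite trmx_mul trmxK.
rewrite mulmxA; move: (v *m P^T) => u.
rewrite mulmxA mxE; apply: eq_bigr => i _; rewrite mul_mx_diag !mxE; ring.
Qed.

Lemma inner_isometry P (v : 'rV[R]_n) : P *m P^T = 1%:M ->
  inner v v = \sum_i (v *m P^T) 0 i ^+ 2.
Proof.
move=> /mulmx1C PP; have -> : inner v v = inner (v *m P^T) (v *m P^T).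
  by rewrite /inner trmx_mul trmxK mulmxA -(mulmxA v) PP mulmx1.
by rewrite innerE; apply: eq_bigr => i _; rewrite expr2.
Qed.

Let minsum (d : 'rV[R]_n) i : \sum_i d 0 i = 1 -> (forall i, 0 <= d 0 i) ->
  0 <= \sum_k Num.min (d 0 k) (d 0 i) <= 1.
Proof.
move=> d1 d0; apply/andP; split.
  by apply: sumr_ge0 => k _; rewrite le_min !d0.
by rewrite -d1; apply: ler_sum => k _; rewrite ge_min lexx.
Qed.

Lemma inner_Sbar_ge0 S v : WF R n S -> 0 <= inner (v *m Sbar S) v.
Proof.
move=> /WF_spectral[P [d [PP -> d0 d1]]].
rewrite Sbar_spectral// inner_spectral; apply: sumr_ge0 => i _.
by rewrite mulr_ge0 ?sqr_ge0// mxE; have /andP[] := minsum i d1 d0.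
Qed.

Lemma inner_Sbar_le S v : WF R n S -> inner (v *m Sbar S) v <= inner v v.
Proof.
move=> /WF_spectral[P [d [PP -> d0 d1]]].
rewrite Sbar_spectral// inner_spectral (inner_isometry v PP).
apply: ler_sum => i _; rewrite -[leRHS]mul1r ler_wpM2r ?sqr_ge0// mxE.
by have /andP[] := minsum i d1 d0.
Qed.

Lemma dbar_bounds S : WF R n S -> 0 <= dbar S <= n%:R.
Proof.
move=> /WF_spectral[P [d [PP -> d0 d1]]].
rewrite /dbar Sbar_spectral// mxtrace_mulC mulmxA PP mul1mx mxtrace_diag.
apply/andP; split.
  by apply: sumr_ge0 => i _; rewrite mxE; have /andP[] := minsum i d1 d0.
have -> : n%:R = \sum_(i < n) (1 : R) by rewrite sumr_const card_ord.
by apply: ler_sum => i _; rewrite mxE; have /andP[] := minsum i d1 d0.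
Qed.

End WF_bounds.

Section measurable_Sbar.
Context {R : realType}.

Lemma continuous_borel_measurable (T : ptopologicalType) (f : T -> R) :
  continuous f -> measurable_fun setT (f : borel T -> R).
Proof.
move=> /continuousP cf.
apply: (measurability _ (@RGenOInfty.measurableE R)) => _ [_ [a ->]] <-.
by rewrite setTI; apply: sub_sigma_algebra; apply: cf; exact: interval_open.
Qed.

Context {n : nat}.
Local Notation M := 'M[R]_n.+1.

Lemma expr_spectral (P : M) (d : 'rV[R]_n.+1) l : P *m P^T = 1%:M ->
  (P^T *m diag_mx d *m P) ^+ l = P^T *m diag_mx (\row_i d 0 i ^+ l) *m P.
Proof.
move=> PP; have PP' := mulmx1C PP; elim: l => [|l IH].
  rewrite expr0 (_ : diag_mx _ = 1%:M) ?mulmx1 ?PP'//.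
  by apply/matrixP => i j; rewrite !mxE expr0.
rewrite exprS IH -[LHS]/(_ *m _) !mulmxA -(mulmxA _ P) PP mulmx1.
congr (_ *m _); rewrite -mulmxA; congr (_ *m _).
apply/matrixP => i j; rewrite mul_diag_mx !mxE exprS.
by case: eqVneq => [->|]; rewrite ?mulr1n ?mulr0n ?mulr0.
Qed.

(** The sum of p(S - z I) over the eigenvalues z of S, with multiplicity,
    expanded by the binomial formula so that only the powers of S and their
    traces appear. *)
Definition trace_poly (p : {poly R}) (S : M) : M :=
  \sum_(j < size p) \sum_(l < j.+1)
    (p`_j * ((-1) ^+ l * 'C(j, l)%:R) * \tr (S ^+ l)) *: S ^+ (j - l).

Lemma trace_poly_spectral p (P : M) (d : 'rV[R]_n.+1) : P *m P^T = 1%:M ->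
  trace_poly p (P^T *m diag_mx d *m P) =
  P^T *m diag_mx (\row_i \sum_k p.[d 0 i - d 0 k]) *m P.
Proof.
move=> PP; have PP' := mulmx1C PP; rewrite /trace_poly.
pose r j l : 'rV[R]_n.+1 := \row_i ((p`_j * ((-1) ^+ l * 'C(j, l)%:R) *
   \sum_k d 0 k ^+ l) * d 0 i ^+ (j - l)).
transitivity (\sum_(j < size p) \sum_(l < j.+1) (P^T *m diag_mx (r j l) *m P)).
  apply: eq_bigr => j _; apply: eq_bigr => l _; rewrite !expr_spectral//.
  rewrite mxtrace_mulC mulmxA PP mul1mx mxtrace_diag scalemxAl scalemxAr.
  congr (_ *m _ *m _); apply/matrixP => a b; rewrite !mxE -[RHS]mulrnAr.
  by congr (_ * _ * _); apply: eq_bigr => k _; rewrite mxE.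
transitivity (P^T *m diag_mx (\sum_(j < size p) \sum_(l < j.+1) r j l) *m P).
  rewrite linear_sum /= mulmx_sumr mulmx_suml; apply: eq_bigr => j _.
  by rewrite linear_sum /= mulmx_sumr mulmx_suml.
congr (_ *m diag_mx _ *m _); apply/rowP => i; rewrite summxE mxE.
under [RHS]eq_bigr do rewrite horner_coef.
rewrite exchange_big/=; apply: eq_bigr => j _; rewrite summxE.
rewrite -mulr_sumr; under [in RHS]eq_bigr do rewrite exprBn.
rewrite exchange_big/= mulr_sumr; apply: eq_bigr => l _; rewrite mxE.
rewrite -!mulrA; congr (_ * _).
transitivity (\sum_k (-1) ^+ l * ('C(j, l)%:R * (d 0 k ^+ l * d 0 i ^+ (j - l)))).
  by rewrite -!mulr_sumr -mulr_suml.
by apply: eq_bigr => k _; rewrite -[RHS]mulr_natl; ring.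
Qed.

(** The eigenvalue of Sbar is sum_k min(d_k, d_i)
    = ((n + 1) d_i + sum_k d_k - sum_k |d_i - d_k|) / 2, where sum_k d_k = 1; the
    differences d_i - d_k lie in [-1, 1], where the polynomials converge. *)
Lemma Sbar_cvg S i j : WF R n.+1 S ->
  2^-1 * (n.+1%:R * S i j + (i == j)%:R - trace_poly (abs_poly m) S i j) @[m --> \oo]
  --> Sbar S i j.
Proof.
move=> /WF_spectral[P [d [PP -> d0 d1]]].
have PP' := mulmx1C PP.
rewrite Sbar_spectral//.
have E (c : 'rV[R]_n.+1) : (P^T *m diag_mx c *m P) i j = \sum_k P k i * c 0 k * P k j.
  by rewrite -mulmxA mul_diag_mx mxE; apply: eq_bigr => k _; rewrite !mxE mulrA.
have IE : (i == j)%:R = \sum_k P k i * P k j.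
  have /matrixP/(_ i j) := PP'; rewrite [RHS]mxE => <-.
  by rewrite mxE; apply: eq_bigr => k _; rewrite !mxE.
pose g m k := 2^-1 * (n.+1%:R * (P k i * d 0 k * P k j) +
   P k i * P k j - P k i * (\sum_l (abs_poly m).[d 0 k - d 0 l]) * P k j).
have gE m : 2^-1 * (n.+1%:R * (P^T *m diag_mx d *m P) i j + (i == j)%:R -
    trace_poly (abs_poly m) (P^T *m diag_mx d *m P) i j) = \sum_k g m k.
  rewrite trace_poly_spectral// !E IE [n.+1%:R * _]mulr_sumr -big_split/= -sumrB.
  by rewrite mulr_sumr; apply: eq_bigr => k _; rewrite mxE.
rewrite (eq_cvg _ _ gE) E.
apply: (@cvg_sumr R nat _ _ (fun k m => g m k)) => k; rewrite !mxE /g.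
have -> : \sum_k0 Num.min (d 0 k0) (d 0 k) =
    2^-1 * (n.+1%:R * d 0 k + 1 - \sum_l `|d 0 k - d 0 l|).
  have -> : n.+1%:R * d 0 k = \sum_(l < n.+1) d 0 k.
    by rewrite sumr_const card_ord mulr_natl.
  rewrite -[X in _ + X - _]d1 -big_split/= -sumrB.
  rewrite mulr_sumr; apply: eq_bigr => l _; case: leP => h.
    by rewrite ger0_norm ?subr_ge0//; field.
  by rewrite ltr0_norm ?subr_lt0//; field.
have -> : P k i * (2^-1 * (n.+1%:R * d 0 k + 1 - \sum_l `|d 0 k - d 0 l|)) * P k j =
   2^-1 * (n.+1%:R * (P k i * d 0 k * P k j) +
   P k i * P k j - P k i * (\sum_l `|d 0 k - d 0 l|) * P k j).
  by move: (\sum_l _) => s; ring.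
apply: cvgMl_tmp; apply: cvgB; first exact: cvg_cst.
apply: cvgMr_tmp; apply: cvgMl_tmp.
apply: (@cvg_sumr R nat _ _ (fun l m => (abs_poly m).[d 0 k - d 0 l])) => l; apply: cvg_abs_poly.
have d1' m : d 0 m <= 1.
  by rewrite -d1 (bigD1 m)//= lerDl; apply: sumr_ge0 => *.
by rewrite ler_norml; apply/andP; split; have := d1' k; have := d1' l;
  have := d0 k; have := d0 l; lra.
Qed.

Lemma measurable_expr (l : nat) (i j : 'I_n.+1) :
  measurable_fun setT (fun S : borel M => ((S : M) ^+ l) i j : R).
Proof.
elim: l i j => [|l IH] i j.
  by under eq_fun do rewrite expr0; exact: measurable_cst.
under eq_fun do rewrite exprS -[X in fun_of_matrix X]/(_ *m _) mxE.
apply: measurable_sum => k; apply: measurable_funM => //.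
apply: (@continuous_borel_measurable M); exact: coord_continuous.
Qed.

Lemma measurable_Sbar i j :
  measurable_fun (WF R n.+1 : set (borel M)) (fun S : borel M => Sbar S i j : R).
Proof.
apply: measurable_fun_cvg => [m|S]; last exact: Sbar_cvg.
apply: measurable_funTS; apply: measurable_funM => //.
apply: measurable_funB.
  apply: measurable_funD => //; apply: measurable_funM => //.
  apply: (@continuous_borel_measurable M); exact: coord_continuous.
under eq_fun do rewrite summxE.
apply: measurable_sum => k; under eq_fun do rewrite summxE.
apply: measurable_sum => l; under eq_fun do rewrite mxE.
apply: measurable_funM; last exact: measurable_expr.
apply: measurable_funM => //.
by apply: measurable_sum => a; exact: measurable_expr.
Qed.

Lemma measurable_dbar : measurable_fun (WF R n.+1 : set (borel M)) (@dbar R n.+1 : borel M -> R).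
Proof. by apply: measurable_sum => i; exact: measurable_Sbar. Qed.

End measurable_Sbar.

(** * Radial vector fields *)

Section is_diff_lemmas.
Context {R : realType} {V W : normedModType R}.

Lemma is_diff_sum n (f df : 'I_n -> V -> W) (y : V) :
  (forall i, is_diff y (f i) (df i)) ->
  is_diff y (fun z => \sum_i f i z) (fun h => \sum_i df i h).
Proof.
elim: n f df => [|n IH] f df fdf.
  under eq_fun do rewrite big_ord0; under [X in is_diff _ _ X]eq_fun do rewrite big_ord0.
  exact: is_diff_cst.
under eq_fun do rewrite big_ord_recr/=.
under [X in is_diff _ _ X]eq_fun do rewrite big_ord_recr/=.
apply: (@is_diffD _ _ _ (fun z => \sum_(i < n) f (widen_ord (leqnSn n) i) z)
  (f ord_max)).
Qed.

Lemma is_diff_coord n (y : 'rV[R]_n) (j : 'I_n) :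
  is_diff y (fun z : 'rV[R]_n => z 0 j : R) (fun h => h 0 j).
Proof.
have @f : {linear 'rV[R]_n -> R}.
  by exists (fun N : 'M[R]_(_, _) => N 0 j); do 2![eexists]; do ?[constructor];
     rewrite ?mxE// => ? *; rewrite ?mxE//; move=> ?; rewrite !mxE.
apply: DiffDef; first exact: differentiable_coord.
rewrite (_ : (fun _ => _) = f) // diff_lin//; exact: coord_continuous.
Qed.

End is_diff_lemmas.

Lemma continuous_matrix (R : realType) (T : topologicalType) m n
    (f : T -> 'M[R]_(m.+1, n.+1)) :
  (forall i j, continuous (fun y => f y i j)) -> continuous f.
Proof.
move=> cf y; apply/cvg_ballP => e e0.
have : \forall z \near y, forall i j, ball (f y i j) e (f z i j).
  apply: filter_forall => i; apply: filter_forall => j.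
  by have /cvg_ballP/(_ e e0) := cf i j y.
by apply: filterS => z; split.
Qed.

Section euclidean_norm.
Context {R : realType} {n : nat}.
Implicit Types (x y u v : 'rV[R]_n).

Lemma enorm_ge0 u : 0 <= enorm u. Proof. exact: sqrtr_ge0. Qed.

Lemma sqr_enorm u : enorm u ^+ 2 = inner u u.
Proof. by rewrite /enorm sqr_sqrtr ?inner_ge0. Qed.

Lemma enormN u : enorm (- u) = enorm u.
Proof. by rewrite /enorm !innerE; congr Num.sqrt; apply: eq_bigr => i _; rewrite !mxE mulrNN. Qed.

Lemma enorm_distC x y : enorm (x - y) = enorm (y - x).
Proof. by rewrite -enormN opprB. Qed.

Lemma coord_le_enorm u i : `|u 0 i| <= enorm u.
Proof.
rewrite -(@ler_pXn2r _ 2) ?nnegrE ?enorm_ge0// sqr_enorm real_normK ?num_real//.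
rewrite innerE (bigD1 i)//= -expr2 lerDl.
by apply: sumr_ge0 => j _; rewrite -expr2 sqr_ge0.
Qed.

End euclidean_norm.

Lemma norm_le_enorm (R : realType) n (u : 'rV[R]_n) : `|u| <= enorm u.
Proof.
rewrite [leLHS]mx_normrE; apply: bigmax_le; first exact: enorm_ge0.
by move=> [i j] _ /=; rewrite ord1 coord_le_enorm.
Qed.

Section radial_field.
Context {R : realType} {n : nat}.
Implicit Types (x y h : 'rV[R]_n.+1).

(** Fields are expressed in the squared distance, which is a polynomial, so that
    nothing singular happens at the centre. *)
Definition qdist x y : R := inner (y - x) (y - x).

Lemma qdist_ge0 x y : 0 <= qdist x y. Proof. exact: inner_ge0. Qed.

Lemma is_diff_shift_coord x y j :
  is_diff y (fun z : 'rV[R]_n.+1 => (z - x) 0 j : R) (fun h => h 0 j).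
Proof.
have -> : (fun z : 'rV[R]_n.+1 => (z - x) 0 j) = (fun z => z 0 j) + cst (- x 0 j).
  by apply/funext => z; rewrite !mxE.
have -> : (fun h : 'rV[R]_n.+1 => h 0 j) = (fun h => h 0 j) + 0.
  by rewrite addr0.
exact: (is_diffD (is_diff_coord y j) (is_diff_cst (- x 0 j) y)).
Qed.

Lemma is_diff_qdist x y : is_diff y (qdist x) (fun h => 2 * inner h (y - x)).
Proof.
have -> : qdist x = (fun z => \sum_i (z - x) 0 i * (z - x) 0 i).
  by apply/funext => z; rewrite /qdist innerE.
apply: is_diff_eq.
  apply: is_diff_sum => i.
  exact: (is_diffM (is_diff_shift_coord x y i) (is_diff_shift_coord x y i)).
apply/funext => h; rewrite innerE mulr_sumr; apply: eq_bigr => i _.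
rewrite /= -[LHS]/((y - x) 0 i * h 0 i + (y - x) 0 i * h 0 i); ring.
Qed.

Lemma continuous_qdist x : continuous (qdist x).
Proof.
by move=> y; apply: differentiable_continuous; have [] := is_diff_qdist x y.
Qed.

Lemma closed_euclidean_ball x (T : R) : closed [set y | qdist x y <= T].
Proof.
rewrite -[X in closed X]/(qdist x @^-1` [set t | t <= T]).
apply: preimage_closed; last exact: closed_le.
by move=> y _; exact: continuous_qdist.
Qed.

Lemma compact_euclidean_ball x (T : R) : compact [set y | qdist x y <= T].
Proof.
apply: bounded_closed_compact; last exact: closed_euclidean_ball.
exists (`|x| + Num.sqrt T); split; first exact: num_real.
move=> M HM y /= yT; apply: le_trans (ltW HM).
rewrite -[y](subrK x) addrC (le_trans (ler_normD _ _))// lerD2l.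
by rewrite (le_trans (norm_le_enorm _))// ler_wsqrtr.
Qed.

(** A closed ball of radius below the distance to the complement stays in
    Omega. *)
Lemma euclidean_ball_sub x (rho : R) Omega : 0 <= rho -> (rho%:E < dist_compl x Omega)%E ->
  [set y | qdist x y <= rho ^+ 2] `<=` Omega.
Proof.
move=> rho0 rhod y /= yr; apply: contrapT => nO.
have : (dist_compl x Omega <= (enorm (x - y))%:E)%E.
  by apply: ereal_inf_lbound; exists y.
move=> /(lt_le_trans rhod); rewrite lte_fin enorm_distC ltNge => /negP; apply.
by rewrite -(ger0_norm rho0) -sqrtr_sqr ler_wsqrtr.
Qed.

Definition radial_field x (Phi : R -> R) y := Phi (qdist x y) *: (y - x).

Variables (x : 'rV[R]_n.+1) (Phi Psi : R -> R).
Hypothesis dPhi : forall t : R, 0 <= t -> is_derive t (1 : R) Phi (- Psi t).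

Lemma is_diff_profile y :
  is_diff y (fun z => Phi (qdist x z)) (fun h => - Psi (qdist x y) * (2 * inner h (y - x))).
Proof.
have dP : is_diff (qdist x y) Phi (fun h : R => - Psi (qdist x y) * h).
  have [d1 d2] := dPhi (qdist_ge0 x y).
  apply: DiffDef; first exact/derivable1_diffP.
  rewrite diff1E; last exact/derivable1_diffP.
  by apply/funext => h; rewrite derive1E d2 mulrC.
exact: (is_diff_comp (is_diff_qdist x y) dP).
Qed.

Lemma is_diff_radial_field y :
  is_diff y (radial_field x Phi)
    (fun h => Phi (qdist x y) *: h - (2 * Psi (qdist x y) * inner h (y - x)) *: (y - x)).
Proof.
pose f j z := Phi (qdist x z) * (z - x) 0 j.
have -> : radial_field x Phi = (fun z => \sum_j f j z *: delta_mx 0 j).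
  apply/funext => z; apply/rowP => k; rewrite summxE (bigD1 k)//= big1 ?addr0.
    by rewrite !mxE !eqxx mulr1 /f !mxE.
  by move=> j jk; rewrite !mxE eqxx eq_sym (negPf jk) mulr0.
apply: is_diff_eq.
  apply: is_diff_sum => j.
  apply: (@is_diff_comp _ _ _ _ (f j) _ ( *:%R ^~ (delta_mx 0 j))).
  exact: (is_diffM (is_diff_profile y) (is_diff_shift_coord x y j)).
apply/funext => h; apply/rowP => k; rewrite summxE (bigD1 k)//= big1 ?addr0.
  rewrite !mxE !eqxx mulr1 /= -[LHS]/(Phi (qdist x y) * h 0 k +
    (y 0 k - x 0 k) * (- Psi (qdist x y) * (2 * inner h (y - x)))).
  by ring.
by move=> j jk; rewrite !mxE eqxx eq_sym (negPf jk) mulr0.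
Qed.

Lemma jacobian_radial_field y : 'J (radial_field x Phi) y =
  (Phi (qdist x y))%:M - (2 * Psi (qdist x y)) *: ((y - x)^T *m (y - x)).
Proof.
have [df dE] := is_diff_radial_field y.
apply/row_matrixP => i; rewrite !rowE /jacobian mul_rV_lin1 dE.
rewrite mulmxBr mul_mx_scalar -scalemxAr mulmxA mul_rV_tr mul_scalar_mx.
by rewrite scalerA.
Qed.

(** The integrand of the first variation, for A = Sbar S. *)
Lemma trace_Sbar_radial_field (A : 'M[R]_n.+1) y :
  \tr (A *m ('J (radial_field x Phi) y)^T) =
  Phi (qdist x y) * \tr A - 2 * Psi (qdist x y) * inner ((y - x) *m A) (y - x).
Proof.
rewrite jacobian_radial_field linearB /= tr_scalar_mx linearZ /= trmx_mul trmxK.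
rewrite mulmxBr linearB /= mul_mx_scalar linearZ /= -scalemxAr linearZ /=.
by rewrite mulmxA mxtrace_mulC mulmxA trace_mx11.
Qed.

Hypothesis cPsi : continuous Psi.

Lemma continuous_jacobian_radial_field :
  continuous (fun y => 'J (radial_field x Phi) y : 'M[R]_n.+1).
Proof.
have -> : (fun y => 'J (radial_field x Phi) y : 'M[R]_n.+1) = (fun y =>
  \matrix_(i, j) (Phi (qdist x y) *+ (i == j) -
     2 * Psi (qdist x y) * ((y - x) 0 i * (y - x) 0 j))).
  apply/funext => y; rewrite jacobian_radial_field; apply/matrixP => i j.
  by rewrite !mxE big_ord1 !mxE.
have cPhi : continuous (fun y => Phi (qdist x y)).
  by move=> y; apply: differentiable_continuous; have [] := is_diff_profile y.
have cPsiq : continuous (fun y => Psi (qdist x y)).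
  by move=> y; apply: continuous_comp; [exact: continuous_qdist|exact: cPsi].
have cc i : continuous (fun y => (y - x) 0 i).
  by move=> y; apply: differentiable_continuous; have [] := is_diff_shift_coord x y i.
apply: continuous_matrix => i j.
have c1 : continuous (fun y => Phi (qdist x y) *+ (i == j)).
  under eq_fun do rewrite mulrb.
  by case: (i == j); [exact: cPhi|exact: (@cst_continuous _ _ (0 : R))].
have c2 : continuous (fun y => 2 * Psi (qdist x y) * ((y - x) 0 i * (y - x) 0 j)).
  move=> y; apply: (@continuousM _ _ (fun y => 2 * Psi (qdist x y))
    (fun y => (y - x) 0 i * (y - x) 0 j)).
    apply: (@continuousM _ _ (fun=> 2) (Psi \o qdist x)); first exact: (@cst_continuous _ _ (2 : R)).
    exact: cPsiq.
  by apply: (@continuousM _ _ (fun y => (y - x) 0 i) (fun y => (y - x) 0 j));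
    exact: cc.
under eq_fun do rewrite mxE.
by move=> y; exact: (continuousB (c1 y) (c2 y)).
Qed.

Lemma C1c_radial_field Omega (rho : R) : 0 <= rho ->
  (rho%:E < dist_compl x Omega)%E -> (forall t, rho ^+ 2 <= t -> Phi t = 0) ->
  C1c Omega (radial_field x Phi).
Proof.
move=> rho0 rhod Phi0.
have sub : supp (radial_field x Phi) `<=` [set y | qdist x y <= rho ^+ 2].
  rewrite /supp closureE => y; apply; split; first exact: closed_euclidean_ball.
  move=> z /=; apply: contraNP => /negP; rewrite -ltNge => /ltW /Phi0.
  by rewrite /radial_field => ->; rewrite scale0r.
split.
- by move=> y; have [] := is_diff_radial_field y.
- exact: continuous_jacobian_radial_field.
- apply: subclosed_compact sub; first exact: closed_closure.
  exact: compact_euclidean_ball.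
- by apply: subset_trans sub _; exact: euclidean_ball_sub.
Qed.

End radial_field.

(** * Profiles with a prescribed derivative *)

Section ftc.
Context {R : realType}.
Local Notation mu := (@lebesgue_measure R).
Implicit Types (f F : R -> R) (a b t : R).

Lemma continuous_integrable_itv f a b : {within `[a, b], continuous f} ->
  mu.-integrable `[a, b] (EFin \o f).
Proof. by move=> cf; apply: continuous_compact_integrable => //; exact: segment_compact. Qed.

Lemma is_derive_Rintegral f a t : continuous f -> a < t ->
  is_derive t (1 : R) (fun s => \int[mu]_(r in `[a, s]) f r)%R (f t).
Proof.
move=> cf at_.
have fi : mu.-integrable `[a, t + 1] (EFin \o f).
  by apply: continuous_integrable_itv; exact: continuous_subspaceT.
have tt : t < t + 1 by rewrite ltrDl.
have [d1 d2] := @continuous_FTC1_closed _ f a t (t + 1) tt fi at_ (cf t).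
apply: DeriveDef; first exact: d1.
by rewrite -derive1E; exact: d2.
Qed.

Lemma Rintegral_FTC2 f F a b : a <= b -> {within `[a, b], continuous f} ->
  (forall t, a <= t <= b -> is_derive t (1 : R) F (f t)) ->
  (\int[mu]_(t in `[a, b]) f t)%R = F b - F a.
Proof.
rewrite le_eqVlt => /predU1P[<- _ _|ab cf dF].
  by rewrite set_itv1 Rintegral_set1 subrr.
have cF t : a <= t <= b -> {for t, continuous F}.
  move=> /dF [dt _]; apply: differentiable_continuous; exact/derivable1_diffP.
rewrite /Rintegral (@continuous_FTC2 _ f F)//.
  split.
  - by move=> t; rewrite in_itv/= => /andP[/ltW at_ /ltW tb]; have [] := dF t; rewrite ?at_.
  - by apply: cvg_at_right_filter; apply: cF; rewrite lexx ltW.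
  - by apply: cvg_at_left_filter; apply: cF; rewrite lexx ltW.
move=> t; rewrite in_itv/= => /andP[/ltW at_ /ltW tb].
by rewrite derive1E; have [] := dF t; rewrite ?at_.
Qed.

(** Phi is the profile in the variable t = r^2.  Its derivative is
    - Psi(t) = - psi(sqrt t) / (2 sqrt t); replacing sqrt t by max(sqrt t, a) in
    the denominator changes nothing, psi vanishing below a, and makes Psi
    continuous on the whole line. *)
Lemma exists_radial_profile (psi : R -> R) (a xi : R) : 0 < a -> 0 < xi ->
  continuous psi -> (forall r, r <= a -> psi r = 0) ->
  (forall r, xi <= r -> psi r = 0) ->
  exists Phi Psi : R -> R,
  [/\ continuous Psi,
      forall t : R, 0 <= t -> is_derive t (1 : R) Phi (- Psi t),
      forall t, xi ^+ 2 <= t -> Phi t = 0,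
      forall r, 0 <= r -> 2 * Psi (r ^+ 2) = psi r / r &
      forall r, 0 <= r <= xi -> Phi (r ^+ 2) = (\int[mu]_(s in `[r, xi]) psi s)%R].
Proof.
move=> a0 xi0 cpsi psia psixi.
pose Psi t := psi (Num.sqrt t) / (2 * Num.max (Num.sqrt t) a).
have max0 t : 0 < Num.max (Num.sqrt t) a by rewrite lt_max a0 orbT.
have cPsi : continuous Psi.
  move=> t; apply: (@continuousM _ _ (psi \o Num.sqrt)
      (fun t => (2 * Num.max (Num.sqrt t) a)^-1)).
    by apply: continuous_comp; [exact: sqrt_continuous|exact: cpsi].
  apply: (@continuousV _ _ (fun t => 2 * Num.max (Num.sqrt t) a)).
    by rewrite mulf_neq0// gt_eqF.
  apply: (@continuousM _ _ (fun=> 2) (fun t => Num.max (Num.sqrt t) a)).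
    exact: (@cst_continuous _ _ (2 : R)).
  apply: (@continuous_max _ _ (@Num.sqrt R) (fun=> a)).
    exact: sqrt_continuous.
  exact: (@cst_continuous _ _ (a : R)).
have PsiE r : 0 <= r -> 2 * Psi (r ^+ 2) = psi r / r.
  move=> r0; rewrite /Psi sqrtr_sqr ger0_norm// mulrCA invfM mulrA.
  have [ra|ar] := leP r a; first by rewrite psia// !mul0r.
  by field; rewrite gt_eqF// (lt_trans a0).
pose F t := (\int[mu]_(r in `[-1, t]) Psi r)%R.
have dF t : 0 <= t -> is_derive t (1 : R) F (Psi t).
  by move=> t0; apply: is_derive_Rintegral => //; rewrite (lt_le_trans _ t0).
pose Phi t := F (xi ^+ 2) - F t.
have dPhi (t : R) : 0 <= t -> is_derive t (1 : R) Phi (- Psi t).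
  move=> t0; rewrite -[- Psi t]add0r.
  by apply: (@is_deriveB _ _ _ (fun=> F (xi ^+ 2)) F); exact: dF.
exists Phi, Psi; split=> //.
- move=> t xit; have h : (\int[mu]_(s in `[xi ^+ 2, t]) Psi s)%R = F t - F (xi ^+ 2).
    apply: Rintegral_FTC2 => //; first exact: continuous_subspaceT.
    by move=> s /andP[s0 _]; apply: dF; rewrite (le_trans _ s0)// sqr_ge0.
  rewrite /Phi -opprB -h.
  rewrite (_ : (\int[mu]_(_ in _) _)%R = 0) ?oppr0//.
  rewrite (@eq_Rintegral _ _ _ _ _ (fun=> 0)) ?Rintegral_cst ?mul0r//.
  move=> s; rewrite inE/= in_itv/= => /andP[xis _].
  by rewrite /Psi psixi ?mul0r// -(ger0_norm (ltW xi0)) -sqrtr_sqr ler_wsqrtr.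
- move=> r /andP[r0 rxi].
  have -> : (\int[mu]_(s in `[r, xi]) psi s)%R = - Phi (xi ^+ 2) - - Phi (r ^+ 2).
    apply: (@Rintegral_FTC2 _ (fun s => - Phi (s ^+ 2))); first exact: rxi.
      exact: continuous_subspaceT.
    move=> s /andP[rs sxi]; have s0 := le_trans r0 rs.
    have -> : psi s = - (- Psi (s ^+ 2) * (2 * s)).
      rewrite mulNr opprK mulrA [_ * 2]mulrC PsiE//.
      have [->|sn0] := eqVneq s 0; first by rewrite mulr0 psia// ltW.
      by field.
    apply: is_deriveN.
    apply: (@is_derive1_comp _ Phi (fun s => s ^+ 2)).
      by apply: dPhi; exact: sqr_ge0.
    have := @is_deriveX R R id 2 s 1 1 (is_derive_id _ _).
    by rewrite /= expr1 scaler1 exprfctE.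
  have P0 : Phi (xi ^+ 2) = 0 by rewrite /Phi subrr.
  by rewrite P0 oppr0 add0r opprK.
Qed.

End ftc.

(** * Exchanging integrals *)

Section bounded_integrals.
Context d (T : measurableType d) {R : realType}.
Implicit Types (m : {measure set T -> \bar R}) (D : set T) (f g : T -> R).

Lemma bounded_integrable m D f (C : R) : measurable D -> (m D < +oo)%E ->
  measurable_fun D f -> (forall y, D y -> `|f y| <= C) -> m.-integrable D (EFin \o f).
Proof.
move=> mD mDoo mf fC; apply: measurable_bounded_integrable => //.
exists C; split; first exact: num_real.
by move=> M CM y Dy; exact: le_trans (fC y Dy) (ltW CM).
Qed.

Lemma Rintegral_bound m D f (C : R) : measurable D -> (m D < +oo)%E ->
  measurable_fun D f -> (forall y, D y -> `|f y| <= C) ->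
  `|\int[m]_(y in D) f y| <= C * fine (m D).
Proof.
move=> mD mDoo mf fC; have fi := bounded_integrable mD mDoo mf fC.
apply: (le_trans (le_normr_Rintegral mD fi)).
rewrite -Rintegral_cst//; apply: le_Rintegral => //.
  apply: (@bounded_integrable _ _ _ C) => //; first exact: measurableT_comp.
  by move=> y Dy; rewrite normr_id fC.
by apply: (@bounded_integrable _ _ _ `|C|) => //; exact: measurable_cst.
Qed.

Lemma EFin_Rintegral m D f : m.-integrable D (EFin \o f) -> measurable D ->
  (\int[m]_(y in D) (f y)%:E)%E = (\int[m]_(y in D) f y)%:E.
Proof. by move=> fi mD; rewrite /Rintegral fineK//; exact: integrable_fin_num. Qed.

Lemma integrable_sumR m D (I : Type) (s : seq I) (h : I -> T -> R) : measurable D ->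
  (forall i, m.-integrable D (EFin \o h i)) ->
  m.-integrable D (EFin \o (fun y => \sum_(i <- s) h i y)).
Proof.
move=> mD hi.
have := @integrable_sum _ _ _ m _ mD I s xpredT (fun i y => (h i y)%:E) (fun i _ => hi i).
by apply: eq_integrable => // y _ /=; rewrite sumEFin.
Qed.

Lemma Rintegral_sum m D (I : Type) (s : seq I) (h : I -> T -> R) : measurable D ->
  (forall i, m.-integrable D (EFin \o h i)) ->
  \int[m]_(y in D) (\sum_(i <- s) h i y) = \sum_(i <- s) \int[m]_(y in D) h i y.
Proof.
move=> mD hi; elim: s => [|i s IH].
  rewrite big_nil (@eq_Rintegral _ _ _ _ _ (fun=> 0)) ?Rintegral_cst ?mul0r// => y _.
  by rewrite big_nil.
rewrite big_cons -IH -RintegralD//; last exact: integrable_sumR.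
by apply: eq_Rintegral => y _; rewrite big_cons.
Qed.

Lemma Rintegral_indicator m D (P : pred T) f :
  \int[m]_(y in D) (f y * (P y)%:R) = \int[m]_(y in D `&` [set y | P y]) f y.
Proof.
rewrite Rintegral_mkcondr; apply: eq_Rintegral => y _; rewrite patchE.
case: ifPn => [|]; first by rewrite inE/= => ->; rewrite mulr1.
by rewrite notin_setE/= => /negP/negPf ->; rewrite mulr0.
Qed.

End bounded_integrals.

(** [patchE] leaves the default value as [point], in which the ring lemmas do
    not recognise 0. *)
Lemma restrE (R : realType) T (E : set T) (g : T -> R) z :
  (g \_ E) z = if z \in E then g z else 0.
Proof. by []. Qed.

Lemma restreE (R : realType) T (E : set T) (g : T -> \bar R) z :
  (g \_ E) z = if z \in E then g z else 0%E.
Proof. by []. Qed.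

(** Fubini on D x I for f(y) psi(s) 1_{r(y) < t(s)}.  Both measures are only known
    to be finite on D and I, so they are first restricted there. *)
Section layer_cake.
Context d (Y : measurableType d) d' (Z : measurableType d') {R : realType}.
Variables (W : {measure set Y -> \bar R}) (leb : {measure set Z -> \bar R}).
Variables (D : set Y).
Hypotheses (mD : measurable D) (WD : (W D < +oo)%E).
Variables (r f : Y -> R) (t psi : Z -> R) (I : set Z) (C B : R).
Hypotheses (mI : measurable I) (lebI : (leb I < +oo)%E).
Hypotheses (mr : measurable_fun setT r) (mt : measurable_fun setT t) (mf : measurable_fun D f)
  (mpsi : measurable_fun I psi).
Hypotheses (fC : forall y, D y -> `|f y| <= C)
  (psiB : forall s, I s -> `|psi s| <= B).

Let m1 := mfrestr mD WD.
Let m2 := mfrestr mI lebI.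
Let F (p : Y * Z) : R := (f \_ D) p.1 * ((psi \_ I) p.2 * (r p.1 < t p.2)%R%:R).

Let m1E (g : Y -> \bar R) :
  (\int[m1]_y (g \_ D) y = \int[W]_(y in D) g y)%E.
Proof.
transitivity (\int[m1]_(y in D) g y)%E; first by rewrite -[LHS]integral_mkcond.
apply: eq_measure_integral => A mA AD.
by rewrite /m1 /mfrestr /mrestr; congr (W _); apply/setIidPl.
Qed.

Let m2E (g : Z -> \bar R) :
  (\int[m2]_y (g \_ I) y = \int[leb]_(y in I) g y)%E.
Proof.
transitivity (\int[m2]_(y in I) g y)%E; first by rewrite -[LHS]integral_mkcond.
apply: eq_measure_integral => A mA AD.
by rewrite /m2 /mfrestr /mrestr; congr (leb _); apply/setIidPl.
Qed.

Lemma measurable_superlevel_indic :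
  measurable_fun setT (fun p : Y * Z => (r p.1 < t p.2)%R%:R : R).
Proof.
have -> : (fun p : Y * Z => (r p.1 < t p.2)%R%:R) = \1_[set p : Y * Z | r p.1 < t p.2] :> (Y * Z -> R).
  apply/funext => p; rewrite indicE; congr (_%:R); congr nat_of_bool.
  by apply/idP/idP; rewrite inE.
apply: measurable_indic.
have mlt : measurable_fun setT (fun p : Y * Z => r p.1 < t p.2).
  apply: measurable_fun_ltr; last exact: (measurableT_comp mt measurable_snd).
  exact: (measurableT_comp mr measurable_fst).
rewrite -[X in measurable X]setTI.
rewrite (_ : [set _ | _] = (fun p : Y * Z => r p.1 < t p.2) @^-1` [set true]).
  exact: mlt.
by apply/seteqP; split=> p.
Qed.

Let mF : measurable_fun setT F.
Proof.
apply: measurable_funM.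
  by apply: (measurableT_comp (f := f \_ D)) => //; exact/(measurable_restrictT _ mD).
apply: measurable_funM; last exact: measurable_superlevel_indic.
by apply: (measurableT_comp (f := psi \_ I)) => //; exact/(measurable_restrictT _ mI).
Qed.

Let bound_restrict (T' : Type) (E : set T') (g : T' -> R) K :
  (forall z, E z -> `|g z| <= K) -> forall z, `|(g \_ E) z| <= `|K|.
Proof.
move=> gK z; rewrite patchE; case: ifPn => [|_]; last by rewrite normr0.
by rewrite inE => /gK /le_trans; apply; exact: ler_norm.
Qed.

Let indic01 (b : bool) : `|b%:R : R| <= 1.
Proof. by case: b; rewrite ?normr1 ?normr0. Qed.

Let iF : (m1 \x m2)%E.-integrable setT (EFin \o F).
Proof.
apply: (@bounded_integrable _ _ _ _ _ _ (`|C| * (`|B| * 1))) => //.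
- apply: (@le_lt_trans _ _ (m1 setT * m2 setT)%E).
    by rewrite -product_measure1E// setXTT.
  rewrite lte_mul_pinfty//.
  + by rewrite ge0_fin_numE// /m1 /mfrestr /mrestr setTI.
  + by rewrite /m2 /mfrestr /mrestr setTI.
- move=> p _; rewrite !normrM; apply: ler_pM => //; first exact: bound_restrict.
  by apply: ler_pM => //; exact: bound_restrict.
Qed.

Let g1 y := \int[leb]_(s in I) (psi s * (r y < t s)%R%:R).
Let g2 s := \int[W]_(y in D) (f y * (r y < t s)%R%:R).

Let m2F y : (\int[m2]_s (F (y, s))%:E = ((f \_ D) y * g1 y)%:E)%E.
Proof.
have mpr : measurable_fun I (fun s => psi s * (r y < t s)%R%:R).
  apply: measurable_funM => //; apply: measurable_funTS.
  have := measurableT_comp measurable_superlevel_indic (pair1_measurable y).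
  exact.
have ipr : leb.-integrable I (EFin \o (fun s => psi s * (r y < t s)%R%:R)).
  apply: (@bounded_integrable _ _ _ _ _ _ (B * 1)) => // s Is.
  by rewrite normrM ler_pM// psiB.
rewrite -RintegralZl// -EFin_Rintegral//; last first.
  exact: (integrableZl mI ((f \_ D) y) ipr).
rewrite -m2E; apply: eq_integral => s _; rewrite /F/= [(psi \_ I) s]restrE restreE.
by case: ifPn => // _; rewrite mul0r mulr0.
Qed.

Let m1F s : (\int[m1]_y (F (y, s))%:E = ((psi \_ I) s * g2 s)%:E)%E.
Proof.
have mpr : measurable_fun D (fun y => f y * (r y < t s)%R%:R).
  apply: measurable_funM => //; apply: measurable_funTS.
  have := measurableT_comp measurable_superlevel_indic (pair2_measurable s).
  exact.
have ipr : W.-integrable D (EFin \o (fun y => f y * (r y < t s)%R%:R)).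
  apply: (@bounded_integrable _ _ _ _ _ _ (C * 1)) => // y Dy.
  by rewrite normrM ler_pM// fC.
rewrite -RintegralZl// -EFin_Rintegral//; last first.
  exact: (integrableZl mD ((psi \_ I) s) ipr).
rewrite -m1E; apply: eq_integral => y _; rewrite /F/= [(f \_ D) y]restrE [RHS]restreE.
by case: ifPn => _; rewrite ?mul0r ?mulr0//= mulrCA.
Qed.

Lemma layer_cake :
  \int[W]_(y in D) (f y * \int[leb]_(s in I) (psi s * (r y < t s)%R%:R)) =
  \int[leb]_(s in I) (psi s * \int[W]_(y in D) (f y * (r y < t s)%R%:R)).
Proof.
have := Fubini iF; rewrite /comp.
under eq_integral do rewrite m2F.
under [RHS]eq_integral do rewrite m1F.
rewrite /Rintegral => h; congr fine; move: h.
rewrite -[X in X = _ -> _]/(\int[m1]_y ((f \_ D) y * g1 y)%:E)%E.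
rewrite (_ : (fun y => ((f \_ D) y * g1 y)%:E) = (fun y => (f y * g1 y)%:E) \_ D); last first.
  by apply/funext => y; rewrite restrE restreE; case: ifPn; rewrite ?mul0r.
rewrite (_ : (fun s => ((psi \_ I) s * g2 s)%:E) = (fun s => (psi s * g2 s)%:E) \_ I); last first.
  by apply/funext => s; rewrite restrE restreE; case: ifPn; rewrite ?mul0r.
by rewrite m1E m2E.
Qed.

Lemma layer_cake_integrable :
  leb.-integrable I
    (EFin \o fun s => psi s * \int[W]_(y in D) (f y * (r y < t s)%R%:R)).
Proof.
pose g s := (psi s * g2 s)%:E.
have gE : (fun s => \int[m1]_y (F (y, s))%:E)%E = g \_ I.
  apply/funext => s; rewrite m1F [(psi \_ I) s]restrE restreE.
  by case: ifPn; rewrite ?mul0r.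
have mg : measurable_fun I (fun s => psi s * g2 s).
  apply/measurable_EFinP; apply/(measurable_restrictT _ mI).
  have := measurable_fubini_G iF.
  by rewrite (_ : fubini_G m1 _ = g \_ I).
apply: (@bounded_integrable _ _ _ _ _ _ (B * (C * fine (W D)))) => // s Is.
rewrite normrM ler_pM// ?psiB// Rintegral_bound//.
  apply: measurable_funM => //; apply: measurable_funTS.
  have := measurableT_comp measurable_superlevel_indic (pair2_measurable s).
  exact.
by move=> y Dy; rewrite normrM -[leRHS]mulr1 ler_pM// fC.
Qed.

End layer_cake.

(** The special case in which s runs over [0, xi] with the Lebesgue measure: the
    inner integral over s > r(y) becomes one over [r(y), xi]. *)
Section layer_cake_lebesgue.
Context d (Y : measurableType d) {R : realType}.
Local Notation leb := (@lebesgue_measure R).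
Variables (W : {measure set Y -> \bar R}) (D : set Y).
Hypotheses (mD : measurable D) (WD : (W D < +oo)%E).
Variables (r f : Y -> R) (psi : R -> R) (xi C B : R).
Hypotheses (mr : measurable_fun setT r) (mf : measurable_fun D f)
  (mpsi : measurable_fun `[0, xi] psi).
Hypotheses (fC : forall y, D y -> `|f y| <= C)
  (psiB : forall s, 0 <= s <= xi -> `|psi s| <= B)
  (rD : forall y, D y -> 0 <= r y <= xi).

Let lebI : (leb `[0%R, xi]%classic < +oo)%E.
Proof. by rewrite lebesgue_measure_itv/=; case: ifPn => // _; rewrite -EFinB ltry. Qed.

Let psiB' s : `[0, xi]%classic s -> `|psi s| <= B.
Proof. by rewrite /= in_itv/=; exact: psiB. Qed.

Lemma layer_cake_lebesgue :
  \int[W]_(y in D) (f y * \int[leb]_(s in `[r y, xi]) psi s) =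
  \int[leb]_(s in `[0, xi]) (psi s * \int[W]_(y in D `&` [set y | r y < s]) f y).
Proof.
have := @layer_cake _ Y _ _ R W leb D mD WD r f id psi `[0, xi] C B
  (measurable_itv _) lebI mr (@measurable_id _ _ setT) mf mpsi fC psiB'.
under [RHS]eq_Rintegral do rewrite Rintegral_indicator.
move=> <-; apply: eq_Rintegral => y; rewrite inE => Dy.
have /andP[r0 rxi] := rD Dy.
rewrite Rintegral_indicator; congr (_ * _).
have -> : `[0, xi]%classic `&` [set s | r y < s] = `]r y, xi]%classic.
  apply/seteqP; split=> s /=; rewrite !in_itv/=.
    by move=> [/andP[_ ->] ->].
  by move=> /andP[rs ->]; rewrite andbT (ltW (le_lt_trans r0 rs)).
rewrite Rintegral_itv_obnd_cbnd//.
apply: (@bounded_integrable _ _ _ _ _ _ B) => //.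
- apply: le_lt_trans lebI; apply: le_measure; rewrite ?inE//.
  by apply: subset_itvr => /=; rewrite bnd_simp.
- apply: measurable_funS mpsi => //.
  by move=> s /=; rewrite !in_itv/= => /andP[rs ->]; rewrite (ltW (le_lt_trans r0 rs)).
- move=> s /=; rewrite in_itv/= => /andP[rs sx].
  by apply: psiB; rewrite sx (ltW (le_lt_trans r0 rs)).
Qed.

Lemma layer_cake_lebesgue_integrable :
  leb.-integrable `[0, xi]
    (EFin \o fun s => psi s * \int[W]_(y in D `&` [set y | r y < s]) f y).
Proof.
have := @layer_cake_integrable _ Y _ _ R W leb D mD WD r f id psi `[0, xi] C B
  (measurable_itv _) lebI mr (@measurable_id _ _ setT) mf mpsi fC psiB'.
by apply: eq_integrable => // s _ /=; rewrite Rintegral_indicator.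
Qed.

End layer_cake_lebesgue.

(** * Compactness, and finiteness on balls *)

Section compactness.
Context {R : realType}.

Lemma WF_coord_le1 n (S : 'M[R]_n) i j : WF R n S -> `|S i j| <= 1.
Proof.
move=> /WF_spectral[P [d [PP -> d0 d1]]].
rewrite -mulmxA mul_diag_mx mxE (le_trans (ler_norm_sum _ _ _))// -d1.
have P1 k l : `|P k l| <= 1.
  have -> : P k l = row k P 0 l by rewrite mxE.
  apply: le_trans (coord_le_enorm _ _) _; rewrite /enorm /inner -sqrtr1 ler_wsqrtr//.
  rewrite rowE trmx_mul mulmxA -(mulmxA _ P) PP mulmx1 trmx_delta mul_delta_mx.
  by rewrite mxE !eqxx.
apply: ler_sum => k _; rewrite !mxE !normrM (ger0_norm (d0 k)).
by rewrite mulrCA ler_piMr// mulr_ile1.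
Qed.

Context {n : nat}.

Lemma continuous_vec_mx : continuous (@vec_mx R n.+1 n.+1).
Proof.
apply: continuous_matrix => i j; under eq_fun do rewrite mxE.
exact: coord_continuous.
Qed.

(** The theorem of Heine and Borel for row vectors, transported by [vec_mx]. *)
Lemma compact_WF : compact (WF R n.+1).
Proof.
have -> : WF R n.+1 = vec_mx @` (vec_mx @^-1` WF R n.+1).
  apply/seteqP; split=> [S SW|_ [v vW <-]//].
  by exists (mxvec S); rewrite /= mxvecK.
apply: continuous_compact; first exact/continuous_subspaceT/continuous_vec_mx.
apply: bounded_closed_compact; last first.
  apply: preimage_closed; last exact: closed_WF.
  by move=> v _; exact: continuous_vec_mx.
exists 1; split; first exact: num_real.
move=> M M1 v /= vW; apply: le_trans (ltW M1).
rewrite [leLHS]mx_normrE; apply: bigmax_le => // -[i k] _ /=; rewrite ord1.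
by case/mxvec_indexP: k => a b; have := WF_coord_le1 a b vW; rewrite mxE.
Qed.

End compactness.

Section balls.
Context {R : realType} {n : nat}.
Implicit Types (x y : 'rV[R]_n.+1) (rho : R).
Local Notation V := 'rV[R]_n.+1.
Local Notation M := 'M[R]_n.+1.

Lemma qdistE x y : qdist x y = enorm (y - x) ^+ 2.
Proof. by rewrite sqr_enorm. Qed.

Lemma measurable_enorm x : measurable_fun setT (fun y : borel V => enorm (y - x) : R).
Proof.
apply: (@continuous_borel_measurable R V) => y.
apply: (@continuous_comp _ _ _ (qdist x) Num.sqrt).
  exact: continuous_qdist.
exact: sqrt_continuous.
Qed.

Lemma measurable_coord_diff x i : measurable_fun setT (fun y : borel V => (y - x) 0 i : R).
Proof.
apply: (@continuous_borel_measurable R V) => y.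
by apply: differentiable_continuous; have [] := is_diff_shift_coord x y i.
Qed.

Lemma measurable_eball x rho : measurable (eball x rho : set (borel V)).
Proof.
have := @measurable_fun_ltr _ (borel V) R setT _ _ (measurable_enorm x)
  (@measurable_cst _ _ (borel V) _ setT rho).
move=> /(_ measurableT [set true] I); rewrite setTI.
by rewrite (_ : _ @^-1` _ = eball x rho)//; apply/seteqP; split=> y.
Qed.

Lemma measurable_eball_WF x rho :
  measurable (eball x rho `*` WF R n.+1 : set (borel V * borel M)).
Proof. by apply: measurableX; [exact: measurable_eball|exact: measurable_WF]. Qed.

Lemma eball_qdist x rho : 0 <= rho -> eball x rho `<=` [set y | qdist x y <= rho ^+ 2].
Proof.
by move=> rho0 y /= /ltW yr; rewrite qdistE ler_pXn2r// nnegrE enorm_ge0.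
Qed.

Lemma radon_in_eball_lty x rho (Omega : set V) (m : {measure set (borel V) -> \bar R}) :
  radon_in Omega m -> 0 <= rho -> (rho%:E < dist_compl x Omega)%E ->
  (m (eball x rho) < +oo)%E.
Proof.
move=> [_ mK] rho0 rhod.
have mc := mK _ (@compact_euclidean_ball _ _ x (rho ^+ 2)) (euclidean_ball_sub rho0 rhod).
apply: le_lt_trans mc; apply: le_measure; rewrite ?inE.
- exact: measurable_eball.
- rewrite -[X in measurable X]setCK; apply: measurableC; apply: sub_sigma_algebra.
  exact/closed_openC/closed_euclidean_ball.
- exact: eball_qdist.
Qed.

Lemma flagfold_eball_lty x rho (Omega : set V)
    (W : {measure set (borel V * borel M) -> \bar R}) :
  flagfold Omega W -> 0 <= rho -> (rho%:E < dist_compl x Omega)%E ->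
  (W (eball x rho `*` WF R n.+1) < +oo)%E.
Proof.
move=> [_ WK] rho0 rhod.
have cK : compact ([set y | qdist x y <= rho ^+ 2] `*` WF R n.+1).
  by apply: compact_setX; [exact: compact_euclidean_ball|exact: compact_WF].
have Ks : [set y | qdist x y <= rho ^+ 2] `*` WF R n.+1 `<=` Omega `*` WF R n.+1.
  by move=> [y S] [/= yr SW]; split=> //; exact: (euclidean_ball_sub rho0 rhod).
apply: le_lt_trans (WK _ cK Ks); apply: le_measure; rewrite ?inE.
- exact: measurable_eball_WF.
- apply: measurableX; last exact: measurable_WF.
  rewrite -[X in measurable X]setCK; apply: measurableC; apply: sub_sigma_algebra.
  exact/closed_openC/closed_euclidean_ball.
- by move=> [y S] [/= yr SW]; split=> //; exact: eball_qdist.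
Qed.

End balls.

(** * The first variation along radial fields *)

Lemma continuous_bounded_itv (R : realType) (f : R -> R) a b :
  {within `[a, b], continuous f} ->
  exists B, forall s, a <= s <= b -> `|f s| <= B.
Proof.
move=> cf; have := continuous_compact cf (@segment_compact _ a b).
move=> /compact_bounded [M [_ HM]]; exists (M + 1) => s sab.
apply: HM; first by rewrite ltrDl.
by exists s => //=; rewrite in_itv.
Qed.

Lemma integral_support d (T : measurableType d) (R : realType)
    (m : {measure set T -> \bar R}) (D E : set T) (f : T -> \bar R) :
  D `<=` E -> (forall y, E y -> ~ D y -> f y = 0%E) ->
  (\int[m]_(y in E) f y = \int[m]_(y in D) f y)%E.
Proof.
move=> DE f0; rewrite integral_mkcond [RHS]integral_mkcond.
apply: eq_integral => y _; rewrite !restreE.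
case: ifPn => [|yE]; case: ifPn => //; rewrite ?inE ?notin_setE.
- by move=> yD yE; exact: f0.
- by move: yE; rewrite notin_setE => yE /DE.
Qed.

Section measurable_integrands.
Context {R : realType} {n : nat}.
Local Notation V := 'rV[R]_n.+1.
Local Notation M := 'M[R]_n.+1.
Implicit Types (x : V) (A : set (borel V)).

Lemma measurable_snd_WF (g : borel M -> R) A : measurable A ->
  measurable_fun (WF R n.+1 : set (borel M)) g ->
  measurable_fun (A `*` WF R n.+1 : set (borel V * borel M)) (fun p => g p.2).
Proof.
move=> mA mg; apply: (@measurable_comp _ _ _ _ _ _ (WF R n.+1 : set (borel M)) g) => //.
- exact: measurable_WF.
- by move=> _ [[y S] [_ SW] <-].
- apply: measurable_funTS; exact: measurable_snd.
Qed.

Lemma measurable_inner_Sbar x A : measurable A ->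
  measurable_fun (A `*` WF R n.+1 : set (borel V * borel M))
    (fun p => inner ((p.1 - x) *m Sbar p.2) (p.1 - x) : R).
Proof.
move=> mA; under eq_fun do rewrite innerE.
have mc i : measurable_fun (A `*` WF R n.+1 : set (borel V * borel M))
    (fun p => (p.1 - x) 0 i : R).
  apply: measurable_funTS.
  exact: (measurableT_comp (measurable_coord_diff x i) measurable_fst).
apply: measurable_sum => i; apply: measurable_funM => //.
under eq_fun do rewrite mxE.
apply: measurable_sum => j; apply: measurable_funM => //.
by apply: (@measurable_snd_WF (fun S => Sbar S j i)) => //; exact: measurable_Sbar.
Qed.

Lemma measurable_enorm_fst x :
  measurable_fun setT (fun p : borel V * borel M => enorm (p.1 - x) : R).
Proof. exact: (measurableT_comp (measurable_enorm x) measurable_fst). Qed.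

End measurable_integrands.

Section radial_identity.
Context {R : realType} {n : nat}.
Local Notation V := 'rV[R]_n.+1.
Local Notation M := 'M[R]_n.+1.
Local Notation leb := (@lebesgue_measure R).
Variables (Omega : set V) (W : {measure set (borel V * borel M) -> \bar R}).
Variables (deltaW : vector_radon Omega) (x : V).

Definition ball_dbar (s : R) : R :=
  \int[W]_(p in eball x s `*` WF R n.+1) dbar p.2.

(** The action of the vector measure on the truncated field 1_{B_s}(y) (y - x),
    which is not smooth enough to be a test field. *)
Definition ball_flux (s : R) : R :=
  \sum_i (\int[vr_pos deltaW i]_(y in eball x s) ((y - x) 0 i)
        - \int[vr_neg deltaW i]_(y in eball x s) ((y - x) 0 i)).

Variable xi : R.
Hypotheses (flagfoldW : flagfold Omega W)
  (deltaWE : represents_first_variation W deltaW)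
  (xi_gt0 : 0 < xi) (xi_lt : (xi%:E < dist_compl x Omega)%E).

Let D : set (borel V * borel M) := eball x xi `*` WF R n.+1.
Let mD : measurable D. Proof. exact: measurable_eball_WF. Qed.
Let WD : (W D < +oo)%E.
Proof. exact: (flagfold_eball_lty flagfoldW (ltW xi_gt0) xi_lt). Qed.

Let m_lty (m : {measure set (borel V) -> \bar R}) : radon_in Omega m ->
  (m (eball x xi) < +oo)%E.
Proof. by move=> rm; exact: (radon_in_eball_lty rm (ltW xi_gt0) xi_lt). Qed.

Let eballI s : s <= xi -> eball x xi `&` [set y : V | enorm (y - x) < s] = eball x s.
Proof.
move=> sxi; apply/seteqP; split=> [y []//|y ys]; split=> //.
exact: lt_le_trans ys sxi.
Qed.

Let eballIW s : s <= xi ->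
  D `&` [set p | enorm (p.1 - x) < s] = eball x s `*` WF R n.+1.
Proof.
move=> sxi; apply/seteqP; split=> [[y S] [[_ /= SW] ys]//|[y S] [ys SW]]; split=> //.
by split=> //; exact: lt_le_trans ys sxi.
Qed.

Let rD0 (p : V) : eball x xi p -> 0 <= enorm (p - x) <= xi.
Proof. by move=> h; rewrite enorm_ge0 ltW. Qed.

Let dbarC p : D p -> `|dbar p.2| <= n.+1%:R.
Proof. by move=> [_ /dbar_bounds /andP[d0 dn]]; rewrite ger0_norm. Qed.

Let coordC i y : eball x xi y -> `|(y - x) 0 i| <= xi.
Proof. by move=> yx; rewrite (le_trans (coord_le_enorm _ _))// ltW. Qed.

Let measurable_dbar_fst : measurable_fun D (fun p => dbar p.2 : R).
Proof.
apply: (@measurable_snd_WF _ _ (@dbar R n.+1)); first exact: measurable_eball.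
exact: measurable_dbar.
Qed.

Lemma layer_cake_dbar (psi : R -> R) (B : R) : measurable_fun `[0, xi] psi ->
  (forall s, 0 <= s <= xi -> `|psi s| <= B) ->
  \int[W]_(p in D) (dbar p.2 * \int[leb]_(s in `[enorm (p.1 - x), xi]) psi s) =
  \int[leb]_(s in `[0, xi]) (psi s * ball_dbar s).
Proof.
move=> mpsi psiB.
have rD p : D p -> 0 <= enorm (p.1 - x) <= xi by move=> [/rD0].
apply: (etrans (@layer_cake_lebesgue _ _ R W D mD WD _ _ psi xi n.+1%:R B
  (@measurable_enorm_fst _ _ x) measurable_dbar_fst mpsi dbarC psiB rD)).
apply: eq_Rintegral => s; rewrite inE/= in_itv/= => /andP[_ sxi].
by rewrite eballIW.
Qed.

Lemma integrable_dbar (psi : R -> R) (B : R) : measurable_fun `[0, xi] psi ->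
  (forall s, 0 <= s <= xi -> `|psi s| <= B) ->
  leb.-integrable `[0, xi] (EFin \o (fun s => psi s * ball_dbar s)).
Proof.
move=> mpsi psiB.
have := @layer_cake_lebesgue_integrable _ _ R W D mD WD (fun p => enorm (p.1 - x))
  (fun p => dbar p.2) psi xi n.+1%:R B.
move=> /(_ (@measurable_enorm_fst _ _ x)) h.
apply: eq_integrable (h _ mpsi dbarC psiB) => //.
move=> s; rewrite inE/= in_itv/= => /andP[_ sxi].
by rewrite eballIW.
Qed.

Let layer_cake_coord (m : {measure set (borel V) -> \bar R}) i (psi : R -> R) (B : R) :
  radon_in Omega m -> measurable_fun `[0, xi] psi ->
  (forall s, 0 <= s <= xi -> `|psi s| <= B) ->
  \int[m]_(y in eball x xi) ((y - x) 0 i * \int[leb]_(s in `[enorm (y - x), xi]) psi s) =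
  \int[leb]_(s in `[0, xi]) (psi s * \int[m]_(y in eball x s) ((y - x) 0 i)) /\
  leb.-integrable `[0, xi] (EFin \o (fun s => psi s * \int[m]_(y in eball x s) ((y - x) 0 i))).
Proof.
move=> rm mpsi psiB; split.
  apply: (etrans (@layer_cake_lebesgue _ (borel V) R m (eball x xi) (measurable_eball x xi)
    (m_lty rm) (fun y => enorm (y - x)) (fun y => (y - x) 0 i) psi xi xi B
    (@measurable_enorm _ _ x) (measurable_funTS (@measurable_coord_diff _ _ x i))
    mpsi (@coordC i) psiB rD0)).
  apply: eq_Rintegral => s; rewrite inE/= in_itv/= => /andP[_ sxi].
  by rewrite eballI.
have := @layer_cake_lebesgue_integrable _ (borel V) R m (eball x xi) (measurable_eball x xi)
    (m_lty rm) (fun y => enorm (y - x)) (fun y => (y - x) 0 i) psi xi xi B.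
move=> /(_ (@measurable_enorm _ _ x)) h.
apply: eq_integrable (h _ mpsi (@coordC i) psiB) => //.
  move=> s; rewrite inE/= in_itv/= => /andP[_ sxi].
  by rewrite eballI.
by apply: measurable_funTS; exact: measurable_coord_diff.
Qed.

(** The field phi(r) (y - x) is an admissible test field; its first variation is
    computed from W on one side and from the vector measure on the other, and in
    both phi is written as an integral of psi. *)
Lemma radial_identity_continuous (psi : R -> R) (a : R) : 0 < a ->
  continuous psi -> (forall r, r <= a -> psi r = 0) ->
  (forall r, xi <= r -> psi r = 0) ->
  \int[leb]_(s in `[0, xi]) (psi s * ball_flux s) =
  \int[leb]_(s in `[0, xi]) (psi s * ball_dbar s) -
  \int[W]_(p in D) (psi (enorm (p.1 - x)) / enorm (p.1 - x) *
     inner ((p.1 - x) *m Sbar p.2) (p.1 - x)).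
Proof.
move=> a0 cpsi psia psixi.
have [Phi [Psi [cPsi dPhi Phi0 PsiE PhiE]]] :=
  exists_radial_profile a0 xi_gt0 cpsi psia psixi.
have [B psiB] := @continuous_bounded_itv _ psi 0 xi (continuous_subspaceT cpsi).
have mpsi : measurable_fun `[0, xi] psi.
  by apply: measurable_funTS; exact: continuous_measurable_fun.
have xi0 := ltW xi_gt0.
have XC1 : C1c Omega (radial_field x Phi).
  exact: (C1c_radial_field dPhi cPsi xi0 xi_lt Phi0).
have DO : D `<=` Omega `*` WF R n.+1.
  by move=> [y S] [/(eball_qdist xi0) yx SW]; split=> //; exact: (euclidean_ball_sub xi0 xi_lt).
have BO : eball x xi `<=` Omega.
  by move=> y /(eball_qdist xi0); exact: (euclidean_ball_sub xi0 xi_lt).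
have far y : ~ eball x xi y -> Phi (qdist x y) = 0 /\ 2 * Psi (qdist x y) = 0.
  move=> /negP; rewrite -leNgt => xiy; rewrite qdistE PsiE ?enorm_ge0// psixi// mul0r.
  by rewrite Phi0// ler_pXn2r// nnegrE enorm_ge0.
have contPhi : continuous (fun y : V => Phi (qdist x y)).
  by move=> y; apply: differentiable_continuous; have [] := is_diff_profile x dPhi y.
have mPhi : measurable_fun setT (fun y : borel V => Phi (qdist x y)).
  exact: (@continuous_borel_measurable R V).
have mPsi : measurable_fun setT (fun y : borel V => 2 * Psi (qdist x y)).
  apply: measurable_funM => //.
  apply: (@continuous_borel_measurable R V) => y.
  by apply: continuous_comp; [exact: continuous_qdist|exact: cPsi].
have [CPhi PhiC] : exists C, forall y, eball x xi y -> `|Phi (qdist x y)| <= C.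
  have [C HC] : exists C, forall s, 0 <= s <= xi ^+ 2 -> `|Phi s| <= C.
    apply: continuous_bounded_itv; apply: derivable_within_continuous => s.
    by rewrite in_itv/= => /andP[s0 _]; have [] := dPhi s s0.
  exists C => y yx; apply: HC; rewrite qdist_ge0; exact: eball_qdist.
have [CPsi PsiC] : exists C, forall y, eball x xi y -> `|2 * Psi (qdist x y)| <= C.
  have [C HC] : exists C, forall s, 0 <= s <= xi ^+ 2 -> `|Psi s| <= C.
    by apply: continuous_bounded_itv; exact: continuous_subspaceT.
  exists (2 * C) => y yx; rewrite normrM ger0_norm// ler_wpM2l//; apply: HC.
  by rewrite qdist_ge0; exact: eball_qdist.
have inner_bound p : D p -> `|inner ((p.1 - x) *m Sbar p.2) (p.1 - x)| <= xi ^+ 2.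
  move=> [px SW]; rewrite ger0_norm ?inner_Sbar_ge0//.
  by rewrite (le_trans (inner_Sbar_le _ SW))//; exact: (eball_qdist xi0 px).
pose f1 (p : V * M) := dbar p.2 * Phi (qdist x p.1).
pose f2 (p : V * M) := 2 * Psi (qdist x p.1) * inner ((p.1 - x) *m Sbar p.2) (p.1 - x).
have i1 : W.-integrable D (EFin \o f1).
  apply: (@bounded_integrable _ _ _ _ _ _ (n.+1%:R * CPhi)) => //.
    apply: measurable_funM.
      apply: (@measurable_snd_WF _ _ (@dbar R n.+1)); first exact: measurable_eball.
      exact: measurable_dbar.
    by apply: measurable_funTS; exact: (measurableT_comp mPhi measurable_fst).
  by move=> p Dp; rewrite normrM ler_pM// ?dbarC// PhiC//; case: Dp.
have i2 : W.-integrable D (EFin \o f2).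
  apply: (@bounded_integrable _ _ _ _ _ _ (CPsi * xi ^+ 2)) => //.
    apply: measurable_funM; last by apply: measurable_inner_Sbar; exact: measurable_eball.
    by apply: measurable_funTS; exact: (measurableT_comp mPsi measurable_fst).
  by move=> p Dp; rewrite normrM ler_pM// ?inner_bound// PsiC//; case: Dp.
have lhsE : first_variation Omega W (radial_field x Phi) =
    (\int[leb]_(s in `[0, xi]) (psi s * ball_dbar s) -
  \int[W]_(p in D) (psi (enorm (p.1 - x)) / enorm (p.1 - x) *
     inner ((p.1 - x) *m Sbar p.2) (p.1 - x)))%:E.
  rewrite /first_variation.
  transitivity (\int[W]_(p in Omega `*` WF R n.+1) (f1 p - f2 p)%:E)%E.
    apply: eq_integral => p _; rewrite (trace_Sbar_radial_field x dPhi)//.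
    by rewrite /f1 mulrC.
  rewrite (integral_support _ DO); last first.
    move=> p [_ SW] nD; have [|e1 e2] := far p.1; first by move=> px; apply: nD.
    by rewrite /f1 /f2 e1 e2 mulr0 mul0r subr0.
  rewrite EFin_Rintegral//; last exact: (integrableB mD i1 i2).
  rewrite RintegralB//; congr (_ - _)%:E.
    rewrite -(layer_cake_dbar mpsi psiB); apply: eq_Rintegral => p.
    rewrite inE => -[px _]; rewrite /f1 qdistE PhiE//; exact: rD0.
  apply: eq_Rintegral => p _.
  by rewrite /f2 qdistE PsiE// enorm_ge0.
have compE (m : {measure set (borel V) -> \bar R}) i : radon_in Omega m ->
    (\int[m]_(y in Omega) (radial_field x Phi y 0 i)%:E)%E =
    (\int[leb]_(s in `[0, xi]) (psi s * \int[m]_(y in eball x s) ((y - x) 0 i)))%:E.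
  move=> rm; have [<- _] := @layer_cake_coord m i psi B rm mpsi psiB.
  rewrite (@integral_support _ (borel V) R m _ _ _ BO); last first.
    by move=> y _ /far[e1 _]; rewrite /radial_field e1 scale0r mxE.
  rewrite EFin_Rintegral; last exact: measurable_eball.
    congr EFin; apply: eq_Rintegral => y; rewrite inE => yx.
    rewrite /radial_field mxE mulrC qdistE PhiE//; exact: rD0.
  apply: (@bounded_integrable _ (borel V) _ _ _ _ (CPhi * xi)).
  - exact: measurable_eball.
  - exact: m_lty.
  - rewrite (_ : (fun y => _) = (fun y => Phi (qdist x y) * (y - x) 0 i)); last first.
      by apply/funext => y; rewrite /radial_field mxE.
    by apply: measurable_funTS; apply: measurable_funM => //; exact: measurable_coord_diff.
  - move=> y yx; rewrite /radial_field mxE normrM ler_pM//; first exact: PhiC.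
    exact: coordC.
have rhsE : vr_integral deltaW (radial_field x Phi) =
    (\int[leb]_(s in `[0, xi]) (psi s * ball_flux s))%:E.
  rewrite /vr_integral.
  under eq_bigr do rewrite (compE _ _ (vr_posP deltaW _)) (compE _ _ (vr_negP deltaW _)).
  under eq_bigr do rewrite -EFinB.
  rewrite sumEFin; congr EFin.
  have ip i := proj2 (@layer_cake_coord _ i psi B (vr_posP deltaW i) mpsi psiB).
  have im i := proj2 (@layer_cake_coord _ i psi B (vr_negP deltaW i) mpsi psiB).
  under eq_bigr do rewrite -RintegralB//.
  rewrite -Rintegral_sum//; last by move=> i; exact: (integrableB _ (ip i) (im i)).
  apply: eq_Rintegral => s _; rewrite /ball_flux mulr_sumr.
  by apply: eq_bigr => i _; rewrite mulrBr.
by have := deltaWE XC1; rewrite lhsE rhsE => -[].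
Qed.

Lemma integrable_flux (psi : R -> R) (B : R) : measurable_fun `[0, xi] psi ->
  (forall s, 0 <= s <= xi -> `|psi s| <= B) ->
  leb.-integrable `[0, xi] (EFin \o (fun s => psi s * ball_flux s)).
Proof.
move=> mpsi psiB.
have ip i := proj2 (@layer_cake_coord _ i psi B (vr_posP deltaW i) mpsi psiB).
have im i := proj2 (@layer_cake_coord _ i psi B (vr_negP deltaW i) mpsi psiB).
have ib i : leb.-integrable `[0, xi] (EFin \o (fun s =>
    psi s * \int[vr_pos deltaW i]_(y in eball x s) ((y - x) 0 i) -
    psi s * \int[vr_neg deltaW i]_(y in eball x s) ((y - x) 0 i))).
  by apply: (integrableB _ (ip i) (im i)).
have : leb.-integrable `[0, xi] (EFin \o (fun s => \sum_i
    (psi s * \int[vr_pos deltaW i]_(y in eball x s) ((y - x) 0 i) -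
    psi s * \int[vr_neg deltaW i]_(y in eball x s) ((y - x) 0 i)))).
  by apply: integrable_sumR => //.
apply: eq_integrable => // s _ /=; congr EFin; rewrite /ball_flux mulr_sumr.
by apply: eq_bigr => i _; rewrite mulrBr.
Qed.

End radial_identity.

(** Dominated convergence for cutoffs converging to an indicator. *)
Section cutoff.
Context d (T : measurableType d) {R : realType}.
Variables (m : {measure set T -> \bar R}) (D : set T) (h : T -> R)
  (c : nat -> T -> R) (P : pred T).
Hypotheses (mD : measurable D) (hi : m.-integrable D (EFin \o h))
  (mc : forall k, measurable_fun D (c k))
  (c01 : forall k y, D y -> `|c k y| <= 1)
  (cP : forall y, D y -> c k y @[k --> \oo] --> ((P y)%:R : R)).

Lemma cvg_Rintegral_cutoff :
  \int[m]_(y in D) (h y * c k y) @[k --> \oo] -->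
  \int[m]_(y in D `&` [set y | P y]) h y.
Proof.
have /measurable_EFinP mh : measurable_fun D (EFin \o h) by case/integrableP: hi.
rewrite -Rintegral_indicator.
have key := @dominated_cvg _ T R m D mD (fun k y => (h y * c k y)%:E)
  (fun y => (h y * (P y)%:R)%:E) (fun y => `|h y|%:E).
apply: fine_cvg; rewrite fineK; last first.
  apply: integrable_fin_num => //.
  apply: le_integrable hi => //; last first.
    by move=> y Dy /=; rewrite lee_fin normrM ler_piMr//; case: (P y); rewrite ?normr1 ?normr0.
  apply: (@emeasurable_fun_cvg _ _ _ _ (fun k y => (h y * c k y)%:E)).
    by move=> k; apply/measurable_EFinP; exact: measurable_funM.
  by move=> y Dy; apply: cvg_EFin; [exact: nearW|apply: cvgMl_tmp; exact: cP].
apply: key => //.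
- by move=> k; apply/measurable_EFinP; exact: measurable_funM.
- by move=> y Dy; apply: cvg_EFin; [exact: nearW|apply: cvgMl_tmp; exact: cP].
- exact: integrable_norm hi.
- by move=> k y Dy /=; rewrite lee_fin normrM ler_piMr// c01.
Qed.

End cutoff.

Section trapezoid.
Context {R : realType}.
Variables (sigma xi : R).
Hypotheses (sigma_gt0 : 0 < sigma) (sx : sigma < xi).

Definition clamp (s : R) : R := Num.min 1 (Num.max 0 s).

(** Equal to 1 on [sigma, xi - 1/K], and 0 outside [sigma - 1/K, xi].  The ramp
    before sigma makes the limit 1 at sigma, the one before xi makes it 0 at xi,
    as in an annulus of open balls; K >= 2 / sigma keeps the support away
    from 0. *)
Definition trapezoid (k : nat) (s : R) : R :=
  let K := k%:R + 2 / sigma in clamp (1 + K * (s - sigma)) * clamp (K * (xi - s)).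

Let clamp01 s : 0 <= clamp s <= 1.
Proof. by rewrite /clamp le_min ler01 le_max lexx ge_min lexx. Qed.

Let clamp1 s : 1 <= s -> clamp s = 1.
Proof.
move=> s1; rewrite /clamp; apply/min_idPl; rewrite le_max s1 orbT//.
Qed.

Let clamp0 s : s <= 0 -> clamp s = 0.
Proof. by move=> s0; rewrite /clamp (max_idPl s0); apply/min_idPr. Qed.

Lemma trapezoid_norm_le1 k s : `|trapezoid k s| <= 1.
Proof.
rewrite /trapezoid/=; have /andP[a0 a1] := clamp01 (1 + (k%:R + 2 / sigma) * (s - sigma)).
have /andP[b0 b1] := clamp01 ((k%:R + 2 / sigma) * (xi - s)).
by rewrite ger0_norm ?mulr_ge0// mulr_ile1.
Qed.

Lemma continuous_trapezoid k : continuous (trapezoid k).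
Proof.
have cclamp : continuous clamp.
  rewrite /clamp => s; apply: (@continuous_min R R (fun=> (1 : R)) (fun s : R => Num.max 0 s)).
    exact: (@cst_continuous _ _ (1 : R)).
  apply: (@continuous_max R R (fun=> (0 : R)) id); last exact: id.
  exact: (@cst_continuous _ _ (0 : R)).
move=> s; rewrite /trapezoid; set K := _ + _.
apply: (@continuousM _ _ (clamp \o (fun s => 1 + K * (s - sigma)))
  (clamp \o (fun s => K * (xi - s)))); apply: continuous_comp; try exact: cclamp.
- apply: cvgD; first exact: cvg_cst.
  by apply: cvgMl_tmp; apply: cvgB; [exact: cvg_id|exact: cvg_cst].
- by apply: cvgMl_tmp; apply: cvgB; [exact: cvg_cst|exact: cvg_id].
Qed.

Let K_gt0 k : 0 < k%:R + 2 / sigma.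
Proof. by rewrite ltr_wpDl// divr_gt0. Qed.

Lemma trapezoid_left k s : s <= sigma / 2 -> trapezoid k s = 0.
Proof.
move=> s2; rewrite /trapezoid/= clamp0 ?mul0r//.
have : (k%:R + 2 / sigma) * (s - sigma) <= (k%:R + 2 / sigma) * (- (sigma / 2)).
  by rewrite ler_pM2l//; lra.
have : (k%:R + 2 / sigma) * (sigma / 2) = k%:R * (sigma / 2) + 1.
  by field; rewrite gt_eqF.
have : 0 <= k%:R * (sigma / 2) by rewrite mulr_ge0// ltW// divr_gt0.
lra.
Qed.

Lemma trapezoid_right k s : xi <= s -> trapezoid k s = 0.
Proof.
move=> xs; rewrite /trapezoid/= [X in _ * X]clamp0 ?mulr0//.
by rewrite pmulr_rle0// subr_le0.
Qed.

Let large (e : R) : 0 < e -> \forall k \near \oo, 1 <= (k%:R + 2 / sigma) * e.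
Proof.
move=> e0; near=> k; have ek : e^-1 <= k%:R by near: k; exact: nbhs_infty_ger.
rewrite -[leLHS](@mulVf _ e) ?gt_eqF// ler_pM2r//.
by rewrite (le_trans ek)// lerDl ltW// divr_gt0.
Unshelve. all: by end_near. Qed.

Lemma cvg_trapezoid s : trapezoid k s @[k --> \oo] --> ((sigma <= s < xi)%R%:R : R).
Proof.
have [ss|ss] := leP sigma s; have [xs|xs] := ltP s xi => /=.
- apply: cvg_near_cst.
  have sx0 : 0 < xi - s by rewrite subr_gt0.
  near=> k; rewrite /trapezoid clamp1; last by rewrite lerDl mulr_ge0 ?subr_ge0 ?(ltW (K_gt0 k)).
  by rewrite clamp1 ?mulr1//; near: k; exact: large.
- by under eq_fun do rewrite trapezoid_right//; exact: cvg_cst.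
- apply: cvg_near_cst.
  have sx0 : 0 < sigma - s by rewrite subr_gt0.
  near=> k; rewrite /trapezoid clamp0 ?mul0r//.
  have : 1 <= (k%:R + 2 / sigma) * (sigma - s) by near: k; exact: large.
  by rewrite -[s - sigma]opprB mulrN; lra.
- by under eq_fun do rewrite trapezoid_right//; exact: cvg_cst.
Unshelve. all: by end_near. Qed.

End trapezoid.

Section radial_identity_window.
Context {R : realType} {n : nat}.
Local Notation V := 'rV[R]_n.+1.
Local Notation M := 'M[R]_n.+1.
Local Notation leb := (@lebesgue_measure R).
Variables (Omega : set V) (W : {measure set (borel V * borel M) -> \bar R}).
Variables (deltaW : vector_radon Omega) (x : V) (sigma xi : R).
Hypotheses (flagfoldW : flagfold Omega W)
  (deltaWE : represents_first_variation W deltaW)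
  (sigma_gt0 : 0 < sigma) (sx : sigma < xi)
  (xi_lt : (xi%:E < dist_compl x Omega)%E).

Let xi_gt0 : 0 < xi. Proof. exact: lt_trans sx. Qed.

Let window : `[0, xi]%classic `&` [set s | sigma <= s < xi] = `[sigma, xi[%classic.
Proof.
apply/seteqP; split=> s /=; rewrite !in_itv/=; first by move=> [].
by move=> /andP[ss sx']; rewrite ss sx' (ltW sx') (le_trans (ltW sigma_gt0) ss).
Qed.

Let annulus : (eball x xi `*` WF R n.+1) `&` [set p : borel V * borel M |
    sigma <= enorm (p.1 - x) < xi] = (eball x xi `\` eball x sigma) `*` WF R n.+1.
Proof.
apply/seteqP; split=> [[y S] [[yx SW] /= /andP[sy _]]|[y S] [[yx ys] SW]].
  by split=> //; split=> //; apply/negP; rewrite -leNgt.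
split; first by split.
by move: ys => /negP; rewrite -leNgt /= => ->.
Qed.

Let cvg_window (h : R -> R) :
  leb.-integrable `[0, xi] (EFin \o h) ->
  \int[leb]_(s in `[0, xi]) (h s * trapezoid sigma xi k s) @[k --> \oo] -->
  \int[leb]_(s in `[sigma, xi]) h s.
Proof.
move=> hi; rewrite -Rintegral_itv_bndo_bndc; last first.
  apply: integrableS hi => //.
  by move=> s /=; rewrite !in_itv/= => /andP[ss /ltW ->]; rewrite (le_trans (ltW sigma_gt0) ss).
rewrite -window.
apply: (@cvg_Rintegral_cutoff _ _ R leb `[0, xi] h (trapezoid sigma xi)) => //.
- by move=> k; apply: measurable_funTS; apply: continuous_measurable_fun; exact: continuous_trapezoid.
- by move=> k s _; exact: trapezoid_norm_le1.
- by move=> s _; exact: cvg_trapezoid.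
Qed.

(** Test with g times a trapezoid and let the slopes go to infinity.  Dividing
    by r is harmless in the limit because all the cutoffs vanish for
    r <= sigma / 2. *)
Lemma radial_identity (g : R -> R) : continuous g ->
  \int[leb]_(s in `[sigma, xi]) (g s * ball_flux deltaW x s) =
  \int[leb]_(s in `[sigma, xi]) (g s * ball_dbar W x s) -
  \int[W]_(p in (eball x xi `\` eball x sigma) `*` WF R n.+1)
     (g (enorm (p.1 - x)) / enorm (p.1 - x) *
      inner ((p.1 - x) *m Sbar p.2) (p.1 - x)).
Proof.
move=> cg.
have [B gB] := @continuous_bounded_itv _ g 0 xi (continuous_subspaceT cg).
have mg : measurable_fun `[0, xi] g.
  by apply: measurable_funTS; exact: continuous_measurable_fun.
pose psi k s := g s * trapezoid sigma xi k s.
have s20 : 0 < sigma / 2 by rewrite divr_gt0.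
have psiE k : \int[leb]_(s in `[0, xi]) (psi k s * ball_flux deltaW x s) =
  \int[leb]_(s in `[0, xi]) (psi k s * ball_dbar W x s) -
  \int[W]_(p in eball x xi `*` WF R n.+1)
     (psi k (enorm (p.1 - x)) / enorm (p.1 - x) *
      inner ((p.1 - x) *m Sbar p.2) (p.1 - x)).
  apply: (@radial_identity_continuous _ _ _ _ _ _ _ flagfoldW deltaWE xi_gt0 xi_lt (psi k)
    (sigma / 2) s20).
  - move=> s; apply: (@continuousM _ _ g (trapezoid sigma xi k)); first exact: cg.
    exact: continuous_trapezoid.
  - by move=> r rs; rewrite /psi trapezoid_left ?mulr0.
  - by move=> r rs; rewrite /psi trapezoid_right ?mulr0.
have lim1 : \int[leb]_(s in `[0, xi]) (psi k s * ball_flux deltaW x s) @[k --> \oo] -->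
    \int[leb]_(s in `[sigma, xi]) (g s * ball_flux deltaW x s).
  have := @cvg_window (fun s => g s * ball_flux deltaW x s)
    (integrable_flux deltaW xi_gt0 xi_lt mg gB).
  by under eq_fun do under eq_Rintegral do rewrite mulrAC.
have lim2 : \int[leb]_(s in `[0, xi]) (psi k s * ball_dbar W x s) @[k --> \oo] -->
    \int[leb]_(s in `[sigma, xi]) (g s * ball_dbar W x s).
  have := @cvg_window (fun s => g s * ball_dbar W x s)
    (integrable_dbar flagfoldW xi_gt0 xi_lt mg gB).
  by under eq_fun do under eq_Rintegral do rewrite mulrAC.
(* agrees with r wherever a cutoff is nonzero, and is invertible *)
pose den (r : R) := Num.max r (sigma / 2).
have den0 r : 0 < den r by rewrite /den lt_max s20 orbT.
have cq : continuous (fun r => g r / den r).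
  move=> r; apply: (@continuousM _ _ g (fun r => (den r)^-1)); first exact: cg.
  apply: (@continuousV _ _ den); first by rewrite gt_eqF.
  apply: (@continuous_max R R id (fun=> sigma / 2)); first exact: id.
  exact: (@cst_continuous _ _ (sigma / 2 : R)).
have [C qC] := @continuous_bounded_itv _ (fun r => g r / den r) 0 xi (continuous_subspaceT cq).
pose h (p : borel V * borel M) := g (enorm (p.1 - x)) / den (enorm (p.1 - x)) *
  inner ((p.1 - x) *m Sbar p.2) (p.1 - x).
have hi : W.-integrable (eball x xi `*` WF R n.+1) (EFin \o h).
  apply: (@bounded_integrable _ _ _ _ _ _ (C * xi ^+ 2)).
  - exact: measurable_eball_WF.
  - exact: (flagfold_eball_lty flagfoldW (ltW xi_gt0) xi_lt).
  - apply: measurable_funM; last by apply: measurable_inner_Sbar; exact: measurable_eball.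
    apply: measurable_funTS.
    exact: (measurableT_comp (continuous_measurable_fun cq) (@measurable_enorm_fst _ _ x)).
  - move=> p [px SW]; rewrite normrM ler_pM//; first by apply: qC; rewrite enorm_ge0 ltW.
    rewrite ger0_norm ?inner_Sbar_ge0//.
    by rewrite (le_trans (inner_Sbar_le _ SW))//; exact: (eball_qdist (ltW xi_gt0) px).
have lim3 : \int[W]_(p in eball x xi `*` WF R n.+1)
     (psi k (enorm (p.1 - x)) / enorm (p.1 - x) *
      inner ((p.1 - x) *m Sbar p.2) (p.1 - x)) @[k --> \oo] -->
  \int[W]_(p in (eball x xi `\` eball x sigma) `*` WF R n.+1)
     (g (enorm (p.1 - x)) / enorm (p.1 - x) *
      inner ((p.1 - x) *m Sbar p.2) (p.1 - x)).
  have := @cvg_Rintegral_cutoff _ _ R W (eball x xi `*` WF R n.+1) h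
    (fun k p => trapezoid sigma xi k (enorm (p.1 - x)))
    (fun p => sigma <= enorm (p.1 - x) < xi) (@measurable_eball_WF _ _ x xi) hi.
  rewrite annulus.
  have -> : \int[W]_(y in (eball x xi `\` eball x sigma) `*` WF R n.+1) h y =
     \int[W]_(p in (eball x xi `\` eball x sigma) `*` WF R n.+1)
     (g (enorm (p.1 - x)) / enorm (p.1 - x) *
      inner ((p.1 - x) *m Sbar p.2) (p.1 - x)).
    apply: eq_Rintegral => p; rewrite inE => -[[_ /negP ps] _]; rewrite /h /den max_l//.
    by move: ps; rewrite -leNgt; apply: le_trans; lra.
  have hE k : \int[W]_(y in eball x xi `*` WF R n.+1) (h y * trapezoid sigma xi k (enorm (y.1 - x))) =
    \int[W]_(p in eball x xi `*` WF R n.+1)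
     (psi k (enorm (p.1 - x)) / enorm (p.1 - x) *
      inner ((p.1 - x) *m Sbar p.2) (p.1 - x)).
    apply: eq_Rintegral => p _; rewrite /h /psi.
    have [r2|r2] := leP (enorm (p.1 - x)) (sigma / 2).
      by rewrite trapezoid_left// !mulr0 !mul0r.
    by rewrite /den max_l ?(ltW r2)//; ring.
  under eq_fun do rewrite hE.
  apply.
  - move=> k; apply: measurable_funTS.
    have ct := @continuous_trapezoid _ sigma xi k.
    exact: (measurableT_comp (continuous_measurable_fun ct) (@measurable_enorm_fst _ _ x)).
  - by move=> k p _; exact: trapezoid_norm_le1.
  - by move=> p _; exact: cvg_trapezoid.
have lim4 : \int[leb]_(s in `[0, xi]) (psi k s * ball_flux deltaW x s) @[k --> \oo] -->
    \int[leb]_(s in `[sigma, xi]) (g s * ball_dbar W x s) -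
    \int[W]_(p in (eball x xi `\` eball x sigma) `*` WF R n.+1)
     (g (enorm (p.1 - x)) / enorm (p.1 - x) *
      inner ((p.1 - x) *m Sbar p.2) (p.1 - x)).
  by rewrite (eq_cvg _ _ psiE); exact: cvgB lim2 lim3.
by rewrite -(cvg_lim (@Rhausdorff R) lim1) -(cvg_lim (@Rhausdorff R) lim4).
Qed.

End radial_identity_window.

(** * The flux is bounded by the total variation *)

Lemma inner_le_enorm (R : realType) n (u v : 'rV[R]_n) : `|inner u v| <= enorm u * enorm v.
Proof.
rewrite -(@ler_pXn2r _ 2) ?nnegrE ?mulr_ge0 ?enorm_ge0// exprMn !sqr_enorm.
rewrite real_normK ?num_real//.
have [->|v0] := eqVneq v 0.
  by rewrite {1}/inner trmx0 mulmx0 mxE expr0n/= mulr_ge0 ?inner_ge0.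
have vv : 0 < inner v v by rewrite lt_neqAle eq_sym inner_eq0 v0 inner_ge0.
have := inner_ge0 (inner v v *: u - inner u v *: v).
have -> : inner (inner v v *: u - inner u v *: v) (inner v v *: u - inner u v *: v) =
    inner v v * (inner u u * inner v v - inner u v ^+ 2).
  have lin a b y : inner (a *: u - b *: v) y = a * inner u y - b * inner v y.
    rewrite !innerE !mulr_sumr -sumrB; apply: eq_bigr => i _; rewrite !mxE; ring.
  rewrite lin (innerC u) (innerC v) !lin (innerC v u); ring.
by rewrite pmulr_rge0// subr_ge0.
Qed.

Section total_variation.
Context {R : realType} {n : nat}.
Local Notation V := 'rV[R]_n.+1.
Variables (Omega : set V) (deltaW : vector_radon Omega).

(** A finite partition is a countable one padded with empty sets. *)
Lemma vr_variation_finite (I : finType) (F : I -> set (borel V)) (B : set (borel V)) (v : R) :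
  (forall k, measurable (F k)) -> trivIset setT F -> \bigcup_k F k = B ->
  (vr_variation deltaW B <= v%:E)%E ->
  \sum_k enorm (vr_val deltaW (F k)) <= v.
Proof.
move=> mF tF FB vv; pose G (j : nat) := nth set0 [seq F k | k <- enum I] j.
have GE k : G (enum_rank k) = F k.
  rewrite /G (nth_map k); first by rewrite nth_enum_rank.
  by have := ltn_ord (enum_rank k); rewrite [X in (_ < X)%N -> _]cardE.
have G0 j : (#|I| <= j)%N -> G j = set0.
  by move=> h; rewrite /G nth_default// size_map -cardE.
have Gcase (j : nat) : (exists2 k, j = enum_rank k :> nat & G j = F k) \/ G j = set0.
  have [jI|jI] := ltnP j #|I|; last by right; exact: G0.
  have kE : enum_rank (enum_val (Ordinal jI)) = Ordinal jI by exact: enum_valK.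
  have kE' : j = enum_rank (enum_val (Ordinal jI)) :> nat by rewrite kE.
  left; exists (enum_val (Ordinal jI)); first exact: kE'.
  by rewrite -GE -kE'.
rewrite -lee_fin; apply: le_trans vv; rewrite -sumEFin.
have -> : (\sum_k (enorm (vr_val deltaW (F k)))%:E =
    \sum_(0 <= j < #|I|) (enorm (vr_val deltaW (G j)))%:E)%E.
  rewrite -big_enum/= -(big_map F xpredT (fun A => (enorm (vr_val deltaW A))%:E)).
  by rewrite (big_nth set0) size_map -cardE.
apply: le_trans (nneseries_lim_ge _ _) _ => [j _ _|]; first by rewrite lee_fin enorm_ge0.
apply: ereal_sup_ubound; exists G => //; split.
- by move=> j; have [[k _ ->]|->] := Gcase j.
- apply/trivIsetP => i j _ _ ij.
  have [[k ik ->]|->] := Gcase i; last by rewrite set0I.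
  have [[l jl ->]|->] := Gcase j; last by rewrite setI0.
  move/trivIsetP : tF; apply => //; apply: contra_neq ij => kl.
  by rewrite ik jl kl.
- rewrite -FB; apply/seteqP; split=> [y [j _ Gj]|y [k _ Fk]].
    by have [[k _ GF]|G00] := Gcase j; [exists k => //; rewrite -GF|move: Gj; rewrite G00].
  by exists (enum_rank k) => //; rewrite GE.
Qed.

(** On a partition of the ball into pieces of grid cells of side e, y - x is
    within e of a vector c of norm at most s on each piece; replacing it by c
    turns the flux into a sum of inner products of c with the values of the
    measure, each at most s times their norm.  The error is at most e times the
    total mass C of the components. *)
Lemma ball_flux_le x (s v : R) : 0 < s -> (s%:E < dist_compl x Omega)%E ->
  (vr_variation deltaW (eball x s) <= v%:E)%E ->
  `|ball_flux deltaW x s| <= s * v.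
Proof.
move=> s0 sd vv; pose B : set (borel V) := eball x s.
have mB : measurable B by exact: measurable_eball.
have Blty (m : {measure set (borel V) -> \bar R}) : radon_in Omega m -> (m B < +oo)%E.
  by move=> rm; exact: (radon_in_eball_lty rm (ltW s0) sd).
pose C := \sum_i (fine (vr_pos deltaW i B) + fine (vr_neg deltaW i B)).
have C0 : 0 <= C by apply: sumr_ge0 => i _; rewrite addr_ge0 ?fine_ge0.
(* C may vanish, hence the division by C + 1 *)
suff H e : 0 < e -> `|ball_flux deltaW x s| <= s * v + e * C.
  apply/ler_addgt0Pr => e e0.
  have C1 : 0 < C + 1 by rewrite ltr_wpDl.
  apply: le_trans (H (e / (C + 1)) _) _; first by rewrite divr_gt0.
  by rewrite lerD2l -mulrA ler_piMr ?(ltW e0)// mulrC ler_pdivrMr// mul1r lerDl.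
move=> e0; pose u (y : V) i := (y - x) 0 i.
have uB y i : B y -> `|u y i| < s by apply: le_lt_trans; exact: coord_le_enorm.
(* the coordinates of y - x shifted by s lie in [0, 2 s[ *)
pose K := (Num.truncn (2 * s / e)).+1.
pose J := {ffun 'I_n.+1 -> 'I_K}.
pose F (f : J) : set (borel V) := B `&` \bigcap_(i in [set: 'I_n.+1])
  [set y | (f i)%:R * e <= u y i + s < (f i).+1%:R * e].
have mu i : measurable_fun setT (fun y : borel V => u y i : R).
  exact: measurable_coord_diff.
have mF f : measurable (F f).
  apply: measurableI => //; apply: fin_bigcap_measurable => // i _.
  have m1 : measurable_fun setT (fun y : borel V => u y i + s) by apply: measurable_funD.
  have := m1 measurableT `[(f i)%:R * e, (f i).+1%:R * e[%classic (measurable_itv _).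
  by rewrite setTI; congr (measurable _); apply/seteqP.
have tF : trivIset setT F.
  apply/trivIsetP => f g _ _ fg; apply/seteqP; split=> // y [[_ yf] [_ yg]].
  move/eqP: fg; apply; apply/ffunP => i; apply: val_inj => /=.
  have := yf i I; have := yg i I; rewrite /= -!ler_pdivlMr// -!ltr_pdivrMr//.
  by move=> /truncn_def <- /truncn_def <-.
have FB : \bigcup_f F f = B.
  apply/seteqP; split=> [y [f _ []]//|y yB].
  have us i : 0 <= (u y i + s) / e.
    rewrite divr_ge0 ?(ltW e0)//.
    by have := uB y i yB; rewrite ltr_norml => /andP[h _]; lra.
  exists [ffun i => inord (Num.truncn ((u y i + s) / e))] => //; split=> // i _ /=.
  rewrite ffunE inordK; last first.
    rewrite truncn_lt_nat// (@lt_trans _ _ (2 * s / e))//.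
      rewrite ltr_pM2r ?invr_gt0//.
      by have := uB y i yB; rewrite ltr_norml => /andP[_ h]; lra.
    by have /andP[] := @truncn_itv _ (2 * s / e) (divr_ge0 (mulr_ge0 (ler0n _ 2) (ltW s0)) (ltW e0)).
  by rewrite -ler_pdivlMr// -ltr_pdivrMr// truncn_itv.
have FsubB f : F f `<=` B by move=> y [].
(* on an empty cell the default x gives c = 0 *)
pose c f := xget x (F f) - x.
have cs f : enorm (c f) <= s.
  rewrite /c; case: xgetP => [y -> [yB _]|_]; first exact: ltW.
  by rewrite subrr /enorm /inner mul0mx mxE sqrtr0 ltW.
have cu f y i : F f y -> `|u y i - c f 0 i| <= e.
  move=> Fy; rewrite /c; case: xgetP => [z _ Fz|/(_ y)//].
  have := Fy.2 i I; have := Fz.2 i I; rewrite /= -/(u z i) -natr1 mulrDl mul1r.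
  by move=> /andP[h1 h2] /andP[h3 h4]; rewrite ler_norml; apply/andP; split; lra.
pose phi i (y : V) := \sum_f c f 0 i * (y \in F f)%:R.
have phiE f y i : F f y -> phi i y = c f 0 i.
  move=> Fy; rewrite /phi (bigD1 f)//= mem_set// mulr1 big1 ?addr0// => g gf.
  rewrite memNset ?mulr0// => Fg; move/trivIsetP : tF => /(_ g f I I gf) h.
  by have : (F g `&` F f) y by []; rewrite h.
have mind f : measurable_fun setT (fun y : borel V => (y \in F f)%:R : R).
  by have := measurable_indic (mF f); apply.
have mphi i : measurable_fun setT (fun y : borel V => phi i y : R).
  by apply: measurable_sum => f; apply: measurable_funM.
have approx (m : {measure set (borel V) -> \bar R}) i : radon_in Omega m ->
    `|\int[m]_(y in B) u y i - \sum_f c f 0 i * fine (m (F f))| <= e * fine (m B).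
  move=> /Blty mlty.
  have bphi y : B y -> `|phi i y| <= s.
    rewrite -FB => -[f _ Fy]; rewrite (phiE f)//.
    exact: le_trans (coord_le_enorm _ _) (cs f).
  have <- : \int[m]_(y in B) phi i y = \sum_f c f 0 i * fine (m (F f)).
    rewrite Rintegral_sum//.
      apply: eq_bigr => f _; rewrite Rintegral_indicator -Rintegral_cst//.
      rewrite (_ : _ `&` _ = F f)//; apply/seteqP; split=> y /=.
        by move=> [_]; rewrite inE.
      by move=> Fy; split; [exact: FsubB Fy|rewrite inE].
    move=> f; apply: (@bounded_integrable _ _ _ _ _ _ `|c f 0 i|) => //.
      by apply: measurable_funTS; apply: measurable_funM.
    by move=> y _; rewrite normrM ler_piMr//; case: (_ \in _); rewrite ?normr1 ?normr0.
  rewrite -RintegralB//.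
  - apply: Rintegral_bound => //.
      by apply: measurable_funB; apply: measurable_funTS.
    by move=> y; rewrite -FB => -[f _ Fy]; rewrite (phiE f)//; exact: cu.
  - apply: (@bounded_integrable _ _ _ _ _ _ s) => //; first exact: measurable_funTS.
    by move=> y /(uB _ i)/ltW.
  - by apply: (@bounded_integrable _ _ _ _ _ _ s) => //; exact: measurable_funTS.
pose S := \sum_i (\sum_f c f 0 i * fine (vr_pos deltaW i (F f)) -
                  \sum_f c f 0 i * fine (vr_neg deltaW i (F f))).
have SE : S = \sum_f inner (c f) (vr_val deltaW (F f)).
  under [RHS]eq_bigr do rewrite innerE.
  rewrite exchange_big/=; apply: eq_bigr => i _; rewrite -sumrB.
  by apply: eq_bigr => f _; rewrite [vr_val _ _ _ _]mxE mulrBr.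
have Sle : `|S| <= s * v.
  rewrite SE (le_trans (ler_norm_sum _ _ _))//.
  apply: (@le_trans _ _ (s * \sum_f enorm (vr_val deltaW (F f)))); last first.
    by rewrite ler_wpM2l ?(ltW s0)//; exact: vr_variation_finite vv.
  rewrite mulr_sumr; apply: ler_sum => f _; apply: le_trans (inner_le_enorm _ _) _.
  by rewrite ler_wpM2r ?enorm_ge0.
rewrite -[ball_flux _ _ _](subrK S) (le_trans (ler_normD _ _))// addrC lerD//.
rewrite /ball_flux /S -sumrB (le_trans (ler_norm_sum _ _ _))// mulr_sumr.
apply: ler_sum => i _.
have := approx _ i (vr_posP deltaW i); have := approx _ i (vr_negP deltaW i).
rewrite /u -/B mulrDr; move: (\sum_f _) (\sum_f _) (Rintegral _ _ _) (Rintegral _ _ _).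
move=> a b p q; rewrite !ler_norml => /andP[h1 h2] /andP[h3 h4].
by apply/andP; split; lra.
Qed.

End total_variation.

(** * Integration by parts against the mass of balls *)

Section mass_by_parts.
Context {R : realType} {n : nat}.
Local Notation V := 'rV[R]_n.+1.
Local Notation M := 'M[R]_n.+1.
Local Notation leb := (@lebesgue_measure R).
Variables (W : {measure set (borel V * borel M) -> \bar R}) (x : V) (sigma xi : R).
Hypotheses (sigma_gt0 : 0 < sigma) (sx : sigma < xi)
  (Wxi : (W (eball x xi `*` WF R n.+1) < +oo)%E).

Definition ball_mass s : R := fine (mass W (eball x s)).

Let xi_gt0 : 0 < xi. Proof. exact: lt_trans sx. Qed.
Let D : set (borel V * borel M) := eball x xi `*` WF R n.+1.
Let A : set (borel V * borel M) := (eball x xi `\` eball x sigma) `*` WF R n.+1.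
Let S : set (borel V * borel M) := eball x sigma `*` WF R n.+1.
Let mD : measurable D. Proof. exact: measurable_eball_WF. Qed.
Let mS : measurable S. Proof. exact: measurable_eball_WF. Qed.
Let mA : measurable A.
Proof.
apply: measurableX; last exact: measurable_WF.
by apply: measurableD; exact: measurable_eball.
Qed.

Let DE : D = A `|` S.
Proof.
apply/seteqP; split=> [[y T] [yx TW]|[y T] [[[yx _] TW]|[ys TW]]]; last 2 first.
- by [].
- by split=> //; exact: lt_trans ys sx.
have [ys|ys] := pselect (eball x sigma y); first by right.
by left.
Qed.

Let AS : [disjoint A & S].
Proof. by apply/disj_setPS => -[y T] [[[_ /= ny] _] [/= ys _]]. Qed.

Variables (h k : R -> R).
Hypotheses (ck : continuous k)
  (dh : forall s : R, sigma <= s <= xi -> is_derive s (1 : R) h (- k s)).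

Let ch : {within `[sigma, xi], continuous h}.
Proof. by apply: derivable_within_continuous => s; rewrite in_itv/= => /dh []. Qed.

Let int_k s : sigma <= s <= xi -> \int[leb]_(t in `[s, xi]) k t = h s - h xi.
Proof.
move=> /andP[ss sxi].
have -> : h s - h xi = - h xi - - h s by rewrite opprK addrC.
apply: (@Rintegral_FTC2 _ k (fun s => - h s)) => //.
  exact: continuous_subspaceT.
move=> t /andP[st tx]; rewrite -[k t]opprK.
apply: (@is_deriveN _ _ _ h); apply: dh.
by rewrite (le_trans ss st).
Qed.

Let clip (p : borel V * borel M) : R := Num.max (enorm (p.1 - x)) sigma.

Let clip_itv p : D p -> sigma <= clip p <= xi.
Proof.
move=> [px _]; rewrite /clip le_max lexx orbT ge_max (ltW sx) andbT/=.
exact: ltW.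
Qed.

Let mclip : measurable_fun setT clip.
Proof. by apply: measurable_maxr => //; exact: measurable_enorm_fst. Qed.

Let hclip_integrable : W.-integrable D (EFin \o (fun p => h (clip p))).
Proof.
have [B hB] := continuous_bounded_itv ch.
apply: (@bounded_integrable _ _ _ _ _ _ B) => //; last by move=> p /clip_itv/hB.
apply: (@measurable_comp _ _ _ _ _ _ `[sigma, xi] h) => //.
- by move=> _ [p /clip_itv Dp <-] /=; rewrite in_itv.
- exact: subspace_continuous_measurable_fun.
- exact: measurable_funTS.
Qed.

Let clipA p : A p -> clip p = enorm (p.1 - x).
Proof. by move=> [[_ /negP ps] _]; rewrite /clip max_l// leNgt. Qed.

Lemma annulus_profile_integrable :
  W.-integrable A (EFin \o (fun p => h (enorm (p.1 - x)))).
Proof.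
have AD : A `<=` D by rewrite DE; exact: subsetUl.
apply: eq_integrable (integrableS mD mA AD hclip_integrable) => // p.
by rewrite inE => /clipA /= ->.
Qed.

Let psi s := k s * (sigma <= s)%R%:R.

Let mpsi : measurable_fun `[0, xi] psi.
Proof.
apply: measurable_funM; first by apply: measurable_funTS; exact: continuous_measurable_fun.
have -> : (fun s : R => (sigma <= s)%R%:R) = \1_(`[sigma, +oo[%classic) :> (R -> R).
  apply/funext => s; rewrite indicE; congr (_%:R); congr nat_of_bool.
  by apply/idP/idP; rewrite inE/= in_itv/= andbT.
exact: measurable_indic.
Qed.

Let psi_bounded : exists B, forall s, 0 <= s <= xi -> `|psi s| <= B.
Proof.
have [B kB] := @continuous_bounded_itv _ k 0 xi (continuous_subspaceT ck).
exists B => s /kB; apply: le_trans; rewrite /psi normrM ler_piMr//.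
by case: (sigma <= s); rewrite ?normr1 ?normr0.
Qed.

Let int_psi p : D p -> \int[leb]_(s in `[enorm (p.1 - x), xi]) psi s = h (clip p) - h xi.
Proof.
move=> Dp; rewrite -int_k ?clip_itv// /psi Rintegral_indicator.
congr (Rintegral _ _ _); apply/seteqP; split=> s /=; rewrite !in_itv/= /clip ge_max.
  by move=> [/andP[-> ->] ->].
by move=> /andP[/andP[-> ->] ->].
Qed.

Let ballW s : s <= xi ->
  D `&` [set p | enorm (p.1 - x) < s] = eball x s `*` WF R n.+1.
Proof.
move=> sxi; apply/seteqP; split=> [[y T] [[_ /= TW] ys]//|[y T] [ys TW]]; split=> //.
by split=> //; exact: lt_le_trans ys sxi.
Qed.

Let rD p : D p -> 0 <= enorm (p.1 - x) <= xi.
Proof. by move=> [px _]; rewrite enorm_ge0 ltW. Qed.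

Let psi_massE s : 0 <= s <= xi ->
  \int[W]_(p in D `&` [set p | enorm (p.1 - x) < s]) 1 = ball_mass s.
Proof.
move=> /andP[_ sxi]; rewrite ballW// Rintegral_cst ?mul1r//.
exact: measurable_eball_WF.
Qed.

Let window : `[0, xi]%classic `&` [set s | sigma <= s] = `[sigma, xi]%classic.
Proof.
apply/seteqP; split=> s /=; rewrite !in_itv/=; first by move=> [/andP[_ ->] ->].
by move=> /andP[ss ->]; rewrite ss (le_trans (ltW sigma_gt0) ss).
Qed.

Let norm1_le (p : borel V * borel M) : D p -> `|1 : R| <= 1.
Proof. by rewrite normr1. Qed.

Lemma ball_mass_integrable :
  leb.-integrable `[sigma, xi] (EFin \o (fun s => k s * ball_mass s)).
Proof.
have [B psiB] := psi_bounded.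
have := @layer_cake_lebesgue_integrable _ _ R W D mD Wxi (fun p => enorm (p.1 - x))
  (fun=> 1) psi xi 1 B (@measurable_enorm_fst _ _ x) (@measurable_cst _ _ _ _ D (1 : R))
  mpsi norm1_le psiB.
move=> h1.
have h2 : leb.-integrable `[sigma, xi] (EFin \o (fun s => psi s *
    \int[W]_(p in D `&` [set p | enorm (p.1 - x) < s]) 1)).
  apply: integrableS h1 => //; rewrite -window; exact: subIsetl.
apply: eq_integrable h2 => // s; rewrite inE/= in_itv/= => /andP[ss sxi].
by rewrite psi_massE ?sxi ?(le_trans (ltW sigma_gt0) ss)// /psi ss mulr1.
Qed.

(** The mass of B_s is the integral of 1_{r < s}.  Exchanging integrals leaves
    the integral of k = - h' over the radii of [sigma, xi] above r, that is
    h(max(r, sigma)) - h(xi). *)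
Lemma mass_by_parts :
  \int[leb]_(s in `[sigma, xi]) (k s * ball_mass s) =
  h sigma * ball_mass sigma - h xi * ball_mass xi +
  \int[W]_(p in A) h (enorm (p.1 - x)).
Proof.
have [B psiB] := psi_bounded.
have := @layer_cake_lebesgue _ _ R W D mD Wxi (fun p => enorm (p.1 - x))
  (fun=> 1) psi xi 1 B (@measurable_enorm_fst _ _ x) (@measurable_cst _ _ _ _ D (1 : R))
  mpsi norm1_le psiB rD.
have -> : \int[leb]_(s in `[0, xi])
    (psi s * \int[W]_(y in D `&` [set y | enorm (y.1 - x) < s]) 1) =
    \int[leb]_(s in `[sigma, xi]) (k s * ball_mass s).
  rewrite -window -Rintegral_indicator; apply: eq_Rintegral => s.
  by rewrite inE/= in_itv/= => sI; rewrite psi_massE// /psi mulrAC.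
move=> <-.
transitivity (\int[W]_(p in D) (h (clip p) - h xi)).
  by apply: eq_Rintegral => p; rewrite inE => Dp; rewrite mul1r int_psi.
have icst : W.-integrable D (EFin \o (fun=> h xi)).
  by apply: (@bounded_integrable _ _ _ _ _ _ `|h xi|).
rewrite RintegralB// Rintegral_cst// [in X in X - _]DE Rintegral_setU//; last first.
  by rewrite -DE.
have -> : \int[W]_(p in A) h (clip p) = \int[W]_(p in A) h (enorm (p.1 - x)).
  by apply: eq_Rintegral => p; rewrite inE => /clipA ->.
have -> : \int[W]_(p in S) h (clip p) = h sigma * ball_mass sigma.
  have -> : h sigma * ball_mass sigma = \int[W]_(p in S) h sigma by rewrite Rintegral_cst.
  by apply: eq_Rintegral => p; rewrite inE => -[/ltW ps _]; rewrite /clip max_r.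
rewrite -[fine (W D)]/(ball_mass xi).
by move: (\int[W]_(p in A) _) => P; ring.
Qed.

End mass_by_parts.

Section weights.
Context {R : realType}.
Variables (L d sigma : R).
Hypothesis sigma_gt0 : 0 < sigma.

(** The weight exp(L s) s^(-d-1) on [sigma, +oo[; below sigma the power is
    constant, for continuity on the whole line. *)
Definition weight (s : R) : R := expR (L * s) * Num.max s sigma `^ (- d - 1).

Lemma weightE s : sigma <= s -> weight s = expR (L * s) * s `^ (- d - 1).
Proof. by move=> ss; rewrite /weight max_l. Qed.

Lemma continuous_weight : continuous weight.
Proof.
move=> s; apply: (@continuousM R R (fun s => expR (L * s))
  (fun s => Num.max s sigma `^ (- d - 1))).
  apply: (@continuous_comp _ _ _ (fun s => L * s) expR); last exact: continuous_expR.
  exact: (cvgMl_tmp (@cvg_id _ _)).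
have cm : {for s, continuous (fun s : R => Num.max s sigma)}.
  apply: (@continuous_max R R id (fun=> sigma)); first exact: id.
  exact: (@cst_continuous _ _ (sigma : R)).
have cp : {for (Num.max s sigma), continuous (fun t : R => t `^ (- d - 1))}.
  apply: differentiable_continuous; apply/derivable1_diffP.
  by apply: ex_derive; apply: is_derive1_powR; rewrite lt_max sigma_gt0 orbT.
exact: (continuous_comp cm cp).
Qed.

(** The density ratio is the product of this factor with the mass of the
    ball. *)
Definition profile (s : R) : R := expR (L * s) * s `^ (- d).

Lemma profileE s : sigma <= s -> profile s = weight s * s.
Proof.
move=> ss; have s0 := lt_le_trans sigma_gt0 ss.
rewrite weightE// /profile -mulrA; congr (_ * _).
by rewrite -[X in _ * X]powRr1 ?ltW// -powRD ?subrK// (gt_eqF s0)/= implybT.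
Qed.

Lemma is_derive_profile s : sigma <= s ->
  is_derive s (1 : R) profile (- (weight s * (d - L * s))).
Proof.
move=> ss; have s0 := lt_le_trans sigma_gt0 ss.
have dp := @is_derive1_powR R (- d) s s0.
have de : is_derive s (1 : R) (fun s => expR (L * s)) (expR (L * s) * L).
  apply: (@is_derive1_comp _ expR (fun s => L * s)).
  have := @is_deriveZ R R R id L s 1 1 (is_derive_id _ _).
  by rewrite /= -[L *: 1]/(L * 1) mulr1.
apply: (is_derive_eq (is_deriveM de dp)).
have pE : s `^ (- d) = s `^ (- d - 1) * s.
  by rewrite -[X in _ * X]powRr1 ?ltW// -powRD ?subrK// (gt_eqF s0)/= implybT.
rewrite weightE//= -![_ *: _]/(_ * _) pE; ring.
Qed.

End weights.

(** * Comparison of density ratios *)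

Section density_ratio.
Context {R : realType} {n : nat}.
Local Notation V := 'rV[R]_n.+1.
Local Notation M := 'M[R]_n.+1.
Local Notation leb := (@lebesgue_measure R).
Variables (Omega : set V) (W : {measure set (borel V * borel M) -> \bar R}).
Variables (x : V) (L d sigma xi : R).
Hypotheses (flagfoldW : flagfold Omega W)
  (sigma_gt0 : 0 < sigma) (sx : sigma < xi)
  (xi_lt : (xi%:E < dist_compl x Omega)%E).

Let A : set (borel V * borel M) := (eball x xi `\` eball x sigma) `*` WF R n.+1.
Let xi_gt0 : 0 < xi. Proof. exact: lt_trans sx. Qed.
Let Wxi : (W (eball x xi `*` WF R n.+1) < +oo)%E.
Proof. exact: (flagfold_eball_lty flagfoldW (ltW xi_gt0) xi_lt). Qed.

Let g := weight L d sigma.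
Let k s := g s * (d - L * s).
Let h := profile L d.

Let ck : continuous k.
Proof.
move=> s; apply: (@continuousM R R g (fun s => d - L * s)).
  exact: continuous_weight.
apply: (@continuousB R R R (fun=> d) (fun s => L * s)).
  exact: (@cst_continuous _ _ (d : R)).
by apply: (@continuousM R R (fun=> L) id); [exact: (@cst_continuous _ _ (L : R))|exact: id].
Qed.

Let dh s : sigma <= s <= xi -> is_derive s (1 : R) h (- k s).
Proof. by move=> /andP[ss _]; exact: is_derive_profile. Qed.

(** The contribution of the part of y - x tangential to the flags. *)
Definition annulus_tangential : R := \int[W]_(p in A)
  (g (enorm (p.1 - x)) / enorm (p.1 - x) * inner ((p.1 - x) *m Sbar p.2) (p.1 - x)).

Lemma mass_density_by_parts :
  \int[leb]_(s in `[sigma, xi]) (g s * (d - L * s) * ball_mass W x s) =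
  h sigma * ball_mass W x sigma - h xi * ball_mass W x xi +
  \int[W]_(p in A) h (enorm (p.1 - x)).
Proof. exact: (mass_by_parts sigma_gt0 sx Wxi ck dh). Qed.

Let A_ge p : A p -> sigma <= enorm (p.1 - x).
Proof. by move=> [[_ /negP]]; rewrite -leNgt. Qed.

Let mA : measurable A.
Proof.
apply: measurableX; last exact: measurable_WF.
by apply: measurableD; exact: measurable_eball.
Qed.

Let hi : W.-integrable A (EFin \o (fun p => h (enorm (p.1 - x)))).
Proof. exact: (annulus_profile_integrable sx Wxi dh). Qed.

Lemma annulus_tangential_bounds p : A p ->
  0 <= g (enorm (p.1 - x)) / enorm (p.1 - x) * inner ((p.1 - x) *m Sbar p.2) (p.1 - x)
    <= h (enorm (p.1 - x)).
Proof.
move=> Ap; have rs := A_ge Ap; have r0 := lt_le_trans sigma_gt0 rs.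
have SW : WF R n.+1 p.2 by case: Ap.
have g0 : 0 <= g (enorm (p.1 - x)).
  by rewrite /g weightE// mulr_ge0 ?expR_ge0// powR_ge0.
apply/andP; split; first by rewrite mulr_ge0 ?divr_ge0 ?enorm_ge0 ?inner_Sbar_ge0.
rewrite /h (profileE _ _ sigma_gt0 rs) -mulrA ler_wpM2l//.
rewrite ler_pdivrMl// -expr2 sqr_enorm; exact: inner_Sbar_le.
Qed.

Lemma annulus_tangential_integrable : W.-integrable A (EFin \o (fun p =>
  g (enorm (p.1 - x)) / enorm (p.1 - x) * inner ((p.1 - x) *m Sbar p.2) (p.1 - x))).
Proof.
apply: le_integrable hi => //.
  apply/measurable_EFinP; apply: measurable_funM; last first.
    by apply: measurable_inner_Sbar; apply: measurableD; exact: measurable_eball.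
  pose q (r : R) := g r / Num.max r sigma.
  have cq : continuous q.
    move=> r; apply: (@continuousM R R g (fun r => (Num.max r sigma)^-1)).
      exact: continuous_weight.
    apply: (@continuousV _ _ (fun r => Num.max r sigma)).
      by rewrite gt_eqF// lt_max sigma_gt0 orbT.
    apply: (@continuous_max R R id (fun=> sigma)); first exact: id.
    exact: (@cst_continuous _ _ (sigma : R)).
  apply: (eq_measurable_fun (fun p : borel V * borel M => q (enorm (p.1 - x)))).
    by move=> p; rewrite inE => /A_ge rs; rewrite /q max_l.
  apply: measurable_funTS.
  exact: (measurableT_comp (continuous_measurable_fun cq) (@measurable_enorm_fst _ _ x)).
move=> p Ap; have /andP[b0 b1] := annulus_tangential_bounds Ap.
by rewrite /= lee_fin !ger0_norm// (le_trans b0).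
Qed.

Lemma radial_identity_weight (deltaW : vector_radon Omega) :
  represents_first_variation W deltaW ->
  \int[leb]_(s in `[sigma, xi]) (g s * ball_flux deltaW x s) =
  \int[leb]_(s in `[sigma, xi]) (g s * ball_dbar W x s) - annulus_tangential.
Proof.
move=> rep; apply: (radial_identity flagfoldW rep sigma_gt0 sx xi_lt).
exact: continuous_weight.
Qed.

Let sub_window : (`[sigma, xi]%classic : set R) `<=` `[0, xi]%classic.
Proof.
by move=> s /=; rewrite !in_itv/= => /andP[ss ->]; rewrite (le_trans (ltW sigma_gt0) ss).
Qed.

Let mg : measurable_fun `[0, xi] g.
Proof. by apply: measurable_funTS; apply: continuous_measurable_fun; exact: continuous_weight. Qed.

Let g_bounded : exists B, forall s, 0 <= s <= xi -> `|g s| <= B.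
Proof.
by apply: continuous_bounded_itv; apply: continuous_subspaceT; exact: continuous_weight.
Qed.

Lemma weight_dbar_integrable :
  leb.-integrable `[sigma, xi] (EFin \o (fun s => g s * ball_dbar W x s)).
Proof.
have [B gB] := g_bounded.
by apply: integrableS (integrable_dbar flagfoldW xi_gt0 xi_lt mg gB).
Qed.

Lemma weight_flux_integrable (deltaW : vector_radon Omega) :
  leb.-integrable `[sigma, xi] (EFin \o (fun s => g s * ball_flux deltaW x s)).
Proof.
have [B gB] := g_bounded.
by apply: integrableS (integrable_flux deltaW xi_gt0 xi_lt mg gB).
Qed.

Lemma weight_mass_integrable :
  leb.-integrable `[sigma, xi] (EFin \o (fun s => g s * (d - L * s) * ball_mass W x s)).
Proof. exact: (ball_mass_integrable sigma_gt0 Wxi ck). Qed.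

Lemma density_ratio_le (deltaW : vector_radon Omega) :
  represents_first_variation W deltaW ->
  (forall s, sigma <= s <= xi -> d * ball_mass W x s <= ball_dbar W x s) ->
  (forall s, sigma <= s <= xi -> `|ball_flux deltaW x s| <= s * (L * ball_mass W x s)) ->
  h sigma * ball_mass W x sigma <= h xi * ball_mass W x xi.
Proof.
move=> rep dbarE fluxE.
have le1 : \int[leb]_(s in `[sigma, xi]) (g s * (d - L * s) * ball_mass W x s) <=
    \int[W]_(p in A) h (enorm (p.1 - x)).
  apply: (@le_trans _ _ annulus_tangential); last first.
    apply: le_Rintegral => //; first exact: annulus_tangential_integrable.
    by move=> p /annulus_tangential_bounds/andP[].
  have -> : annulus_tangential = \int[leb]_(s in `[sigma, xi])
      (g s * ball_dbar W x s - g s * ball_flux deltaW x s).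
    rewrite RintegralB//; last 2 first.
    - exact: weight_dbar_integrable.
    - exact: weight_flux_integrable.
    by rewrite (radial_identity_weight rep) opprB addrCA subrr addr0.
  apply: le_Rintegral => //.
  - exact: weight_mass_integrable.
  - exact: (integrableB _ weight_dbar_integrable (weight_flux_integrable _)).
  - move=> s /=; rewrite in_itv/= => sI.
    rewrite -mulrBr -mulrA ler_wpM2l//.
      rewrite /g weightE; last by case/andP: sI.
      by rewrite mulr_ge0 ?expR_ge0 ?powR_ge0.
    have := dbarE s sI; have := fluxE s sI; rewrite ler_norml => /andP[_].
    by move: (ball_mass _ _ _) (ball_dbar _ _ _) (ball_flux _ _ _) => a b c; nra.
by move: le1; rewrite mass_density_by_parts; lra.
Qed.

End density_ratio.

(** A stationary flagfold is one whose first variation is represented by the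
    zero measure, so that the radial identity applies with zero flux. *)
Section stationary.
Context {R : realType} {n : nat}.
Local Notation V := 'rV[R]_n.+1.
Variable Omega : set V.

Lemma radon_in_mzero : radon_in Omega (mzero : {measure set (borel V) -> \bar R}).
Proof. by split=> // K _ _; exact: ltry. Qed.

Definition zero_radon : vector_radon Omega :=
  VectorRadon (fun=> radon_in_mzero) (fun=> radon_in_mzero).

Lemma zero_radon_represents W :
  (forall X, C1c Omega X -> first_variation Omega W X = 0%E) ->
  represents_first_variation W zero_radon.
Proof.
move=> W0 X /W0 ->; rewrite /vr_integral big1// => i _.
by rewrite /= !integral_measure_zero sube0.
Qed.

Lemma ball_flux_zero x s : ball_flux zero_radon x s = 0.
Proof.
rewrite /ball_flux big1// => i _.
by rewrite /= /Rintegral !integral_measure_zero subr0.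
Qed.

End stationary.

(** * Disintegration *)

Local Open Scope ereal_scope.

(** Iterated integrals are an instance of the composition of kernels, over a
    one-point parameter space. *)
Section kernels.
Context d d' (Y : measurableType d) (Z : measurableType d') {R : realType}.

Section cst_kernel.
Variable m : {finite_measure set Y -> \bar R}.

Definition cst_kernel (_ : unit) : {measure set Y -> \bar R} := m.

Let measurable_cst_kernel U : measurable U -> measurable_fun setT (cst_kernel ^~ U).
Proof. by move=> mU; exact: measurable_cst. Qed.

HB.instance Definition _ :=
  isKernel.Build _ _ _ _ _ cst_kernel measurable_cst_kernel.

Let cst_kernel_uub : measure_fam_uub cst_kernel.
Proof.
exists (fine (m setT) + 1)%R => u; rewrite /cst_kernel EFinD fineK ?fin_num_measure//.
by rewrite lteDl ?lte01// fin_num_measure.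
Qed.

HB.instance Definition _ :=
  Kernel_isFinite.Build _ _ _ _ _ cst_kernel cst_kernel_uub.

End cst_kernel.

Section snd_kernel.
Variable w : R.-pker Y ~> Z.

Definition snd_kernel (p : unit * Y) : {measure set Z -> \bar R} := w p.2.

Let measurable_snd_kernel U : measurable U -> measurable_fun setT (snd_kernel ^~ U).
Proof.
move=> mU; exact: (measurableT_comp (measurable_kernel w U mU) measurable_snd).
Qed.

HB.instance Definition _ :=
  isKernel.Build _ _ _ _ _ snd_kernel measurable_snd_kernel.

Let snd_kernel_prob p : snd_kernel p setT = 1.
Proof. exact: prob_kernel. Qed.

HB.instance Definition _ :=
  Kernel_isProbability.Build _ _ _ _ _ snd_kernel snd_kernel_prob.

End snd_kernel.

End kernels.

Lemma ge0_integral_mrestr d (T : measurableType d) (R : realType)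
    (mu : {measure set T -> \bar R}) (D : set T) (mD : measurable D) (f : T -> \bar R) :
  measurable_fun setT f -> (forall y, 0 <= f y) ->
  \int[mrestr mu mD]_y f y = \int[mu]_(y in D) f y.
Proof.
move=> mf f0; rewrite (@ge0_negligible_integral _ _ _ _ setT (~` D))//; last 2 first.
- exact: measurableC.
- by rewrite -[LHS]/(mu (~` D `&` D)) setICl measure0.
rewrite setTD setCK; apply: eq_measure_integral => A mA AD.
by rewrite /mrestr; congr (mu _); exact/setIidPl.
Qed.

Section disintegration.
Context {R : realType} {n : nat}.
Local Notation V := 'rV[R]_n.
Local Notation M := 'M[R]_n.
Variables (W : {measure set (borel V * borel M) -> \bar R})
  (w : R.-pker (borel V) ~> (borel M)).
Hypothesis disW : disintegration W w.

(** The composed kernel and the image of W restricted to B x M under the second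
    projection are the same measure, by the disintegration of the rectangles
    B x A. *)
Lemma disintegration_integral (B : set (borel V)) (f : borel M -> \bar R) :
  measurable B -> mass W B < +oo -> measurable_fun setT f -> (forall S, 0 <= f S) ->
  \int[mass W]_(y in B) \int[w y]_S f S = \int[W]_(p in B `*` setT) f p.2.
Proof.
move=> mB Boo mf f0; pose m := mfrestr mB Boo.
have mBT : measurable (B `*` setT : set (borel V * borel M)) by exact: measurableX.
have mg : measurable_fun setT (fun y => \int[w y]_S f S).
  by apply: measurable_fun_integral_kernel => // U mU; exact: measurable_kernel.
have key := @integral_kcomp _ _ _ unit (borel V) (borel M) R
  (cst_kernel m) (snd_kernel w) tt f f0 mf.
have <- : \int[m]_y \int[w y]_S f S = \int[mass W]_(y in B) \int[w y]_S f S.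
  by apply: ge0_integral_mrestr => // y; exact: integral_ge0.
transitivity (\int[kcomp (cst_kernel m) (snd_kernel w) tt]_S f S); first by rewrite key.
have -> : \int[W]_(p in B `*` setT) f p.2 = \int[mrestr W mBT]_p f p.2.
  by rewrite ge0_integral_mrestr//; exact: (measurableT_comp mf measurable_snd).
have := @ge0_integral_pushforward _ _ (borel V * borel M)%type (borel M) R snd
   measurable_snd (mrestr W mBT) setT f measurableT mf (fun y _ => f0 y).
rewrite preimage_setT => <-.
apply: eq_measure_integral => A mA _.
transitivity (\int[mass W]_(y in B) w y A).
  have <- : \int[m]_y w y A = \int[mass W]_(y in B) w y A.
    by apply: ge0_integral_mrestr => //; exact: measurable_kernel.
  by [].
transitivity (W (B `*` A)); last first.
  rewrite -[RHS]/(W (snd @^-1` A `&` (B `*` setT))); congr (W _).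
  by apply/seteqP; split=> [[y S] [/= yB SA]|[y S] [/= SA [yB _]]].
rewrite disW.2; last exact: measurableX.
rewrite integral_mkcond; apply: eq_integral => y _; rewrite restreE.
case: ifPn => yB; first by rewrite in_xsectionX.
by rewrite notin_xsectionX// measure0.
Qed.

End disintegration.

Lemma integral_mean_dbar (R : realType) n
    (W : {measure set (borel 'rV[R]_n.+1 * borel 'M[R]_n.+1) -> \bar R})
    (w : R.-pker (borel 'rV[R]_n.+1) ~> (borel 'M[R]_n.+1))
    (B : set (borel 'rV[R]_n.+1)) (d : R) :
  disintegration W w -> measurable B -> mass W B < +oo ->
  \int[mass W]_(y in B) (mean_dbar w y - d%:E) =
  (\int[W]_(p in B `*` WF R n.+1) (dbar p.2 : R) - d * fine (mass W B))%R%:E.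
Proof.
move=> disW mB Boo; pose f : borel 'M[R]_n.+1 -> \bar R := (EFin \o @dbar R n.+1) \_ (WF R n.+1).
have mWF := @measurable_WF R n.+1.
have mf : measurable_fun setT f.
  by apply/(measurable_restrictT _ mWF)/measurable_EFinP; exact: measurable_dbar.
have f0 S : 0 <= f S.
  by rewrite /f restreE; case: ifPn => //; rewrite inE => /dbar_bounds/andP[h _]; rewrite lee_fin.
have mBW : measurable (B `*` WF R n.+1 : set (borel 'rV[R]_n.+1 * borel 'M[R]_n.+1)).
  exact: measurableX.
have mbar : measurable_fun (B `*` WF R n.+1 : set (borel 'rV[R]_n.+1 * borel 'M[R]_n.+1))
    (fun p => dbar p.2 : R).
  by apply: (@measurable_snd_WF _ _ (@dbar R n.+1)) => //; exact: measurable_dbar.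
have meanE y : mean_dbar w y = \int[w y]_S f S.
  by rewrite /mean_dbar integral_mkcond.
have mmean : measurable_fun setT (mean_dbar w : borel 'rV[R]_n.+1 -> \bar R).
  rewrite (funext meanE).
  by apply: measurable_fun_integral_kernel => // U mU; exact: measurable_kernel.
have mean0 y : 0 <= mean_dbar w y by rewrite meanE; exact: integral_ge0.
have intE : \int[mass W]_(y in B) mean_dbar w y =
    (\int[W]_(p in B `*` WF R n.+1) (dbar p.2 : R))%R%:E.
  under eq_integral do rewrite meanE.
  rewrite (disintegration_integral disW)//.
  have BTW : B `*` WF R n.+1 `<=` B `*` setT by move=> [y S] [].
  rewrite (@integral_support _ (borel 'rV[R]_n.+1 * borel 'M[R]_n.+1)%type R W _ _ _ BTW); last first.
    by move=> [y S] [yB _] nW; rewrite /f restreE memNset// => SW; apply: nW.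
  rewrite -EFin_Rintegral//.
    by apply: eq_integral => p; rewrite inE => -[_ SW]; rewrite /f restreE mem_set.
  apply: (@bounded_integrable _ _ _ _ _ _ n.+1%:R) => //.
  by move=> p [_ /dbar_bounds/andP[h1 h2]]; rewrite ger0_norm.
have imean : (mass W).-integrable B (mean_dbar w : borel 'rV[R]_n.+1 -> \bar R).
  apply/integrableP; split; first exact: measurable_funTS.
  under eq_integral do rewrite gee0_abs//.
  by rewrite intE ltry.
have icst : (mass W).-integrable B (fun _ : borel 'rV[R]_n.+1 => d%:E).
  by apply: (@bounded_integrable _ _ _ _ _ (fun=> d) `|d|%R).
have massE : mass W B = (fine (mass W B))%:E by rewrite fineK// ge0_fin_numE.
rewrite integralB// intE integral_cst// EFinB EFinM; congr (_ - _ * _).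
exact: massE.
Qed.

(** * The monotonicity formula *)

Section main.
Context {R : realType} {n : nat}.
Local Notation V := 'rV[R]_n.+1.
Local Notation M := 'M[R]_n.+1.
Local Notation leb := (@lebesgue_measure R).
Variables (Omega : set V) (W : {measure set (borel V * borel M) -> \bar R}).
Variables (w : R.-pker (borel V) ~> (borel M)) (x : V) (d : R).
Hypotheses (flagfoldW : flagfold Omega W) (disW : disintegration W w).

Lemma mass_ball s : (0 <= s)%R -> s%:E < dist_compl x Omega ->
  mass W (eball x s) = (ball_mass W x s)%:E.
Proof.
move=> s0 sd; rewrite /ball_mass fineK// ge0_fin_numE//.
exact: (flagfold_eball_lty flagfoldW s0 sd).
Qed.

Lemma integral_ball_mean_dbar s : (0 <= s)%R -> s%:E < dist_compl x Omega ->
  \int[mass W]_(y in eball x s) (mean_dbar w y - d%:E) =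
  (ball_dbar W x s - d * ball_mass W x s)%R%:E.
Proof.
move=> s0 sd; apply: integral_mean_dbar => //; first exact: measurable_eball.
exact: (flagfold_eball_lty flagfoldW s0 sd).
Qed.

Lemma density_monotone (deltaW : vector_radon Omega) (Lambda rhos : R) :
  represents_first_variation W deltaW ->
  rhos%:E < dist_compl x Omega ->
  (forall rho : R, (0 < rho <= rhos)%R ->
     0 <= \int[mass W]_(y in eball x rho) (mean_dbar w y - d%:E)) ->
  (forall rho : R, (0 < rho <= rhos)%R ->
     vr_variation deltaW (eball x rho) <= Lambda%:E * mass W (eball x rho)) ->
  forall rho1 rho2 : R, (0 < rho1)%R -> (rho1 <= rho2)%R -> (rho2 <= rhos)%R ->
     (expR (Lambda * rho1) * rho1 `^ (- d))%:E * mass W (eball x rho1) <=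
     (expR (Lambda * rho2) * rho2 `^ (- d))%:E * mass W (eball x rho2).
Proof.
move=> rep rhos_lt dbar_ge dW rho1 rho2 r10; rewrite le_eqVlt => /predU1P[<-//|r12] r2.
have dist s : (s <= rhos)%R -> s%:E < dist_compl x Omega.
  by move=> srhos; apply: le_lt_trans rhos_lt; rewrite lee_fin.
have r20 := lt_trans r10 r12.
rewrite !mass_ball ?(ltW r10) ?(ltW r20)//; last 2 first.
- exact: dist.
- by apply: dist; exact: le_trans (ltW r12) r2.
rewrite -!EFinM lee_fin.
apply: (density_ratio_le flagfoldW r10 r12 (dist _ r2) rep) => s /andP[s1 s2].
  have s0 := lt_le_trans r10 s1; have srhos := le_trans s2 r2.
  have := dbar_ge s; rewrite s0 srhos => /(_ isT).
  by rewrite integral_ball_mean_dbar ?(ltW s0)// ?lee_fin ?subr_ge0//; exact: dist.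
have s0 := lt_le_trans r10 s1; have srhos := le_trans s2 r2.
apply: ball_flux_le => //; first exact: dist.
have := dW s; rewrite s0 srhos => /(_ isT).
by rewrite mass_ball ?(ltW s0)//; exact: dist.
Qed.

Lemma stationary_identity :
  (forall X, C1c Omega X -> first_variation Omega W X = 0) ->
   forall sigma xi : R, (0 < sigma)%R -> (sigma < xi)%R ->
     xi%:E < dist_compl x Omega ->
     mass W (eball x xi) * ((xi `^ d)^-1)%:E -
     mass W (eball x sigma) * ((sigma `^ d)^-1)%:E =
     \int[W]_(p in (eball x xi `\` eball x sigma) `*` WF R n.+1)
        (inner ((p.1 - x) *m Sbar_perp p.2) (p.1 - x) /
         enorm (p.1 - x) `^ (d + 2))%:E +
     \int[leb]_(rho in `[sigma, xi])
        ((rho `^ (- d - 1))%:E *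
         \int[mass W]_(y in eball x rho) (mean_dbar w y - d%:E)).
Proof.
move=> W0 sigma xi s0 sx xid; have x0 := lt_trans s0 sx.
have Wxi := flagfold_eball_lty flagfoldW (ltW x0) xid.
have dist s : (s <= xi)%R -> s%:E < dist_compl x Omega.
  by move=> sxi; apply: le_lt_trans xid; rewrite lee_fin.
rewrite !mass_ball ?(ltW s0) ?(ltW x0)//; last by apply: dist; exact: ltW.
set A := (_ `\` _) `*` _.
have mA : measurable (A : set (borel V * borel M)).
  apply: measurableX; last exact: measurable_WF.
  by apply: measurableD; exact: measurable_eball.
have rA (p : borel V * borel M) : A p -> (sigma <= enorm (p.1 - x))%R.
  by move=> [[_ /negP]]; rewrite -leNgt.
have wE s : (sigma <= s)%R -> (weight 0 d sigma s = s `^ (- d - 1))%R.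
  by move=> ss; rewrite weightE// mul0r expR0 mul1r.
have it := annulus_tangential_integrable 0 d flagfoldW s0 sx xid.
have ih : W.-integrable A (EFin \o (fun p => profile 0 d (enorm (p.1 - x)))).
  apply: (annulus_profile_integrable sx Wxi (k := fun s => (weight 0 d sigma s * (d - 0 * s))%R)).
  by move=> s /andP[ss _]; exact: is_derive_profile.
have -> : \int[W]_(p in A) (inner ((p.1 - x) *m Sbar_perp p.2) (p.1 - x) /
         enorm (p.1 - x) `^ (d + 2))%:E =
    ((\int[W]_(p in A) profile 0 d (enorm (p.1 - x))) -
     annulus_tangential W x 0 d sigma xi)%R%:E.
  rewrite /annulus_tangential -RintegralB// -EFin_Rintegral//; last exact: (integrableB mA ih it).
  apply: eq_integral => p; rewrite inE => Ap; congr EFin.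
  have rs := rA p Ap; have r0 := lt_le_trans s0 rs.
  rewrite (profileE 0 d s0 rs) wE// /Sbar_perp.
  have -> : inner ((p.1 - x) *m (1%:M - Sbar p.2)) (p.1 - x) =
     (enorm (p.1 - x) ^+ 2 - inner ((p.1 - x) *m Sbar p.2) (p.1 - x))%R.
    by rewrite sqr_enorm mulmxBr mulmx1 {1}/inner mulmxBl [LHS]mxE [X in (_ + X)%R]mxE.
  have -> : ((enorm (p.1 - x) `^ (d + 2))^-1 =
     (enorm (p.1 - x) `^ (- d - 1) / enorm (p.1 - x)))%R.
    rewrite -powRN -[X in (_ / X)%R](powRr1 (ltW r0)) -powRN -powRD.
      by congr (_ `^ _)%R; ring.
    by rewrite (gt_eqF r0) implybT.
  move: (inner _ _) (_ `^ _)%R => b e; field; rewrite gt_eqF//.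
have -> : \int[leb]_(rho in `[sigma, xi]) ((rho `^ (- d - 1))%:E *
         \int[mass W]_(y in eball x rho) (mean_dbar w y - d%:E)) =
    ((\int[leb]_(s in `[sigma, xi]) (weight 0 d sigma s * ball_dbar W x s)) -
     \int[leb]_(s in `[sigma, xi]) (weight 0 d sigma s * (d - 0 * s) * ball_mass W x s))%R%:E.
  have i1 := weight_dbar_integrable 0 d flagfoldW s0 sx xid.
  have i2 := weight_mass_integrable 0 d flagfoldW s0 sx xid.
  rewrite -RintegralB// -EFin_Rintegral//; last exact: (integrableB _ i1 i2).
  apply: eq_integral => s; rewrite inE/= in_itv/= => /andP[ss sxi].
  rewrite integral_ball_mean_dbar ?(le_trans (ltW s0) ss)//; last exact: dist.
  by rewrite -EFinM; congr EFin; rewrite wE//; ring.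
have := radial_identity_weight 0 d flagfoldW s0 sx xid (zero_radon_represents W0).
rewrite (@eq_Rintegral _ _ _ _ _ (fun=> 0%R)); last first.
  by move=> s _; rewrite ball_flux_zero mulr0.
rewrite Rintegral_cst// mul0r => e0.
rewrite (mass_density_by_parts 0 d flagfoldW s0 sx xid).
rewrite /profile !mul0r expR0 !mul1r !powRN -!EFinM -EFinB -EFinD; congr EFin.
move: e0; move: (annulus_tangential _ _ _ _ _ _) => a.
move: (ball_mass _ _ _) (ball_mass _ _ _) => b c.
move: (Rintegral _ _ _) (Rintegral _ _ _) => e f; lra.
Qed.

End main.

Theorem proposition7p6 (R : realType) (n : nat) (Omega : set 'rV[R]_n)
  (W : {measure set (borel 'rV[R]_n * borel 'M[R]_n) -> \bar R})
  (w : R.-pker (borel 'rV[R]_n) ~> (borel 'M[R]_n))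
  (deltaW : vector_radon Omega)
  (x : 'rV[R]_n) (Lambda d rhos : R)
  (openOmega : open Omega)
  (flagfoldW : flagfold Omega W)
  (disW : disintegration W w)
  (lbfvW : locally_bounded_first_variation Omega W)
  (deltaWE : represents_first_variation W deltaW)
  (xOmega : Omega x)
  (Lambda_ge0 : (0 <= Lambda)%R)
  (d_gt0 : (0 < d)%R) (d_le : (d <= n%:R)%R)
  (rhos_gt0 : (0 < rhos)%R) (rhos_lt : rhos%:E < dist_compl x Omega)
  (dbar_ge : forall rho : R, (0 < rho <= rhos)%R ->
     0 <= \int[mass W]_(y in eball x rho) (mean_dbar w y - d%:E))
  (deltaW_le : forall rho : R, (0 < rho <= rhos)%R ->
     vr_variation deltaW (eball x rho) <=
     Lambda%:E * mass W (eball x rho)) :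
  (forall rho1 rho2 : R, (0 < rho1)%R -> (rho1 <= rho2)%R -> (rho2 <= rhos)%R ->
     (expR (Lambda * rho1) * rho1 `^ (- d))%:E * mass W (eball x rho1) <=
     (expR (Lambda * rho2) * rho2 `^ (- d))%:E * mass W (eball x rho2))
  /\
  ((forall X, C1c Omega X -> first_variation Omega W X = 0) ->
   forall sigma xi : R, (0 < sigma)%R -> (sigma < xi)%R ->
     xi%:E < dist_compl x Omega ->
     mass W (eball x xi) * ((xi `^ d)^-1)%:E -
     mass W (eball x sigma) * ((sigma `^ d)^-1)%:E =
     \int[W]_(p in (eball x xi `\` eball x sigma) `*` WF R n)
        (inner ((p.1 - x) *m Sbar_perp p.2) (p.1 - x) /
         enorm (p.1 - x) `^ (d + 2))%:E +
     \int[lebesgue_measure]_(rho in `[sigma, xi])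
        ((rho `^ (- d - 1))%:E *
         \int[mass W]_(y in eball x rho) (mean_dbar w y - d%:E))).
Proof.
(* in dimension 0 the bounds on d are contradictory *)
destruct n as [|n]; first by move: d_le; rewrite leNgt d_gt0.
split.
  exact: (density_monotone flagfoldW disW deltaWE rhos_lt dbar_ge deltaW_le).
exact: stationary_identity.
Qed.
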